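(* Let $\mathcal{L}$ be a minimal Lagrangian surface of $\mathbb{D}^2$ with indefinite induced metric. Then, locally, $\mathcal{L}$ is a product $\gamma_1\times J\gamma_2\subset P\oplus JP$, where $\gamma_1$ and $\gamma_2$ are two planar curves contained in a non-Lagrangian (and therefore non-complex) null plane $P$. That is, every point of $\mathcal{L}$ has an open neighbourhood in $\mathcal{L}$ for which there exist a two-dimensional real linear subspace $P\subset\mathbb{D}^2$ on which $\langle\cdot,\cdot\rangle$ vanishes identically, on which $\omega$ does not vanish identically, and which is not $J$-stable, with $\mathbb{D}^2=P\oplus JP$, and two regular curves $\gamma_1:I_1\to P$, $\gamma_2:I_2\to P$ defined on open intervals, such that the neighbourhood is parametrized by $(u,v)\in I_1\times I_2\mapsto\gamma_1(u)+J\gamma_2(v)$.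
   Context: $\mathbb{D}$ is the algebra of para-complex numbers $z=x+\tau y$, $x,y\in\mathbb{R}$, $\tau^2=1$. On $\mathbb{D}^2\simeq\mathbb{R}^4$ with coordinates $z_j=x_j+\tau y_j$, $j=1,2$, $J(z_1,z_2)=(\tau z_1,\tau z_2)$, the metric is $\langle\cdot,\cdot\rangle=dx_1^2-dy_1^2+dx_2^2-dy_2^2$, and the symplectic form is $\omega=\langle\cdot,J\cdot\rangle$. A surface $\mathcal{L}\subset\mathbb{D}^2$ (real dimension 2) is Lagrangian if $\omega$ vanishes on it. Its induced metric is indefinite if it is non-degenerate of signature $(1,1)$. The surface is minimal if its mean curvature vector $\vec H$ vanishes, where $2\vec H=\sum_{i=1}^2\epsilon_i h(e_i,e_i)$ for a local orthonormal tangent frame $(e_1,e_2)$ with $\epsilon_i=\langle e_i,e_i\rangle=\pm1$, $h(X,Y)=(D_XY)^\perp$, and $D$ is the flat connection of $\mathbb{D}^2$. A plane is null if the metric restricted to it vanishes identically. *)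

(* Defs.v *)
(* Everything is over an arbitrary R : realType, standing for the reals. *)
From HB Require Import structures.
From mathcomp Require Import all_boot all_order all_algebra.
From mathcomp Require Import all_classical all_reals all_analysis.

Set Implicit Arguments.
Unset Strict Implicit.
Unset Printing Implicit Defensive.

Import Order.TTheory GRing.Theory Num.Theory.
Import numFieldNormedType.Exports.

Local Open Scope classical_set_scope.
Local Open Scope ring_scope.

(* The para-complex number x + tau y is the pair (x, y). The ring product
   "*" that MathComp puts on pairs is the componentwise one, NOT the
   para-complex product, which is pcmul. *)
Notation paracomplex R := (R * R)%type (only parsing).
Notation paracomplex2 R := (paracomplex R * paracomplex R)%type (only parsing).

Definition pcmul (R : realType) (z w : paracomplex R) : paracomplex R :=
  (z.1 * w.1 + z.2 * w.2, z.1 * w.2 + z.2 * w.1).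

Definition tau (R : realType) : paracomplex R := (0, 1).

Lemma tau_sqr (R : realType) : pcmul (tau R) (tau R) = (1, 0).
Proof. by rewrite /pcmul /= !(mulr0, mul0r, mulr1, add0r). Qed.

Definition J (R : realType) (z : paracomplex2 R) : paracomplex2 R :=
  (pcmul (tau R) z.1, pcmul (tau R) z.2).

(* Needed for J @: P to be the image of P under J, through linfun. *)
Lemma J_is_linear (R : realType) : linear (@J R).
Proof.
move=> a [[x1 y1] [x2 y2]] [[x1' y1'] [x2' y2']].
by rewrite /J /pcmul /= !(mul0r, mul1r, add0r).
Qed.

HB.instance Definition _ (R : realType) :=
  GRing.isLinear.Build R (paracomplex2 R) (paracomplex2 R) *:%R (@J R)
    (@J_is_linear R).

Definition metric (R : realType) (z w : paracomplex2 R) : R :=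
  z.1.1 * w.1.1 - z.1.2 * w.1.2 + z.2.1 * w.2.1 - z.2.2 * w.2.2.

Definition omega (R : realType) (z w : paracomplex2 R) : R := metric z (J w).

(* C^n on an open set U: iterated directional derivatives up to order n exist,
   are differentiable (below order n) and continuous. *)
Fixpoint Cn_on (R : realType) (V W : normedModType R) (n : nat) (U : set V)
    (f : V -> W) : Prop :=
  match n with
  | O => forall x, U x -> {for x, continuous f}
  | n'.+1 => (forall x, U x -> differentiable f x) /\
             (forall v : V, Cn_on n' U (fun x => 'D_v f x))
  end.

Definition smooth_on (R : realType) (V W : normedModType R) (U : set V)
    (f : V -> W) : Prop := forall n, Cn_on n U f.

(* phi is a local parametrization of L: a smooth immersion of the open set U of
   R^2 that is a homeomorphism onto a relatively open subset of L (the last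
   clause: phi is injective, continuous, and open as a map into L). *)
Definition local_param (R : realType) (L : set (paracomplex2 R))
    (U : set (R * R)) (phi : R * R -> paracomplex2 R) : Prop :=
  [/\ open U,
      smooth_on U phi,
      forall q, U q -> injective ('d phi q : R * R -> paracomplex2 R),
      set_inj U phi &
      forall V : set (R * R), open V -> V `<=` U ->
        exists2 W : set (paracomplex2 R), open W & phi @` V = L `&` W].

(* Smooth embedded surfaces: L carries the topology induced by D^2. *)
Definition surface (R : realType) (L : set (paracomplex2 R)) : Prop :=
  forall p, L p -> exists U phi, local_param L U phi /\ (phi @` U) p.

Definition tangent_plane (R : realType) (phi : R * R -> paracomplex2 R)
    (q : R * R) : set (paracomplex2 R) :=
  range ('d phi q : R * R -> paracomplex2 R).

Definition lagrangian (R : realType) (L : set (paracomplex2 R)) : Prop :=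
  forall U phi, local_param L U phi -> forall q, U q ->
  forall X Y, tangent_plane phi q X -> tangent_plane phi q Y ->
  omega X Y = 0.

(* For a set T underlying a 2-plane: the metric restricted to T is
   non-degenerate and has an orthogonal basis with signs (+, -). *)
Definition nondegenerate11 (R : realType) (T : set (paracomplex2 R)) : Prop :=
  (forall X, T X -> (forall Y, T Y -> metric X Y = 0) -> X = 0) /\
  (exists X Y, [/\ T X, T Y, metric X Y = 0, 0 < metric X X &
                   metric Y Y < 0]).

Definition indefinite_metric (R : realType) (L : set (paracomplex2 R)) : Prop :=
  forall U phi, local_param L U phi -> forall q, U q ->
  nondegenerate11 (tangent_plane phi q).

(* The component of Z normal to T; it exists and is unique when the metric is
   non-degenerate on T. *)
Definition normal_part (R : realType) (T : set (paracomplex2 R))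
    (Z : paracomplex2 R) : paracomplex2 R :=
  xget 0 [set N | (forall X, T X -> metric X N = 0) /\ T (Z - N)].

(* Tangent vector fields are given in the parameter domain by X : R^2 -> R^2;
   the corresponding field along phi is dphi(X). *)
Definition push (R : realType) (phi : R * R -> paracomplex2 R)
    (X : R * R -> R * R) (q : R * R) : paracomplex2 R := 'd phi q (X q).

(* h(X, Y) = (D_X Y)^perp: for the flat connection, D_X Y is the derivative of
   the field dphi(Y) in the parameter direction X. *)
Definition second_ff (R : realType) (phi : R * R -> paracomplex2 R)
    (X Y : R * R -> R * R) (q : R * R) : paracomplex2 R :=
  normal_part (tangent_plane phi q) ('D_(X q) (push phi Y) q).

Definition orthonormal_frame (R : realType) (U : set (R * R))
    (phi : R * R -> paracomplex2 R) (e1 e2 : R * R -> R * R)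
    (eps1 eps2 : R) : Prop :=
  [/\ smooth_on U e1 /\ smooth_on U e2,
      (eps1 = 1 \/ eps1 = -1) /\ (eps2 = 1 \/ eps2 = -1) &
      forall q, U q ->
        [/\ metric (push phi e1 q) (push phi e1 q) = eps1,
            metric (push phi e2 q) (push phi e2 q) = eps2 &
            metric (push phi e1 q) (push phi e2 q) = 0]].

Definition mean_curvature (R : realType) (phi : R * R -> paracomplex2 R)
    (e1 e2 : R * R -> R * R) (eps1 eps2 : R) (q : R * R) : paracomplex2 R :=
  2^-1 *: (eps1 *: second_ff phi e1 e1 q + eps2 *: second_ff phi e2 e2 q).

(* The mean curvature vector does not depend on the parametrization or on the
   orthonormal frame, so it suffices that L is covered by parametrizations with
   frames in which it vanishes. *)
Definition minimal (R : realType) (L : set (paracomplex2 R)) : Prop :=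
  forall p, L p -> exists U phi e1 e2 eps1 eps2,
    [/\ local_param L U phi, (phi @` U) p,
        orthonormal_frame U phi e1 e2 eps1 eps2 &
        forall q, U q -> mean_curvature phi e1 e2 eps1 eps2 q = 0].

Definition null_plane (R : realType) (P : {vspace paracomplex2 R}) : Prop :=
  \dim P = 2%N /\ (forall X Y, X \in P -> Y \in P -> metric X Y = 0).

Definition lagrangian_plane (R : realType) (P : {vspace paracomplex2 R}) :
    Prop :=
  \dim P = 2%N /\ (forall X Y, X \in P -> Y \in P -> omega X Y = 0).

Definition JP (R : realType) (P : {vspace paracomplex2 R}) :
    {vspace paracomplex2 R} := (linfun (@J R) @: P)%VS.

Definition complex_plane (R : realType) (P : {vspace paracomplex2 R}) : Prop :=
  \dim P = 2%N /\ (JP P <= P)%VS.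

Definition open_interval (R : realType) (I : set R) : Prop :=
  [/\ I !=set0, open I & is_interval I].

Definition regular_curve (R : realType) (I : set R)
    (gamma : R -> paracomplex2 R) : Prop :=
  smooth_on (V := R) I gamma /\ forall t, I t -> derive1 gamma t != 0.

(* Main.v *)
Require Import Defs.
From HB Require Import structures.
From mathcomp Require Import all_boot all_order all_algebra.
From mathcomp Require Import all_classical all_reals all_analysis.
From mathcomp Require Import ring lra.
Import Order.TTheory GRing.Theory Num.Theory.
Import numFieldNormedType.Exports.
Local Open Scope classical_set_scope.
Local Open Scope ring_scope.
Set Implicit Arguments.
Unset Strict Implicit.
Unset Printing Implicit Defensive.

(** Write [p_j = x_j + y_j], [q_j = x_j - y_j] for the null coordinates of
    [D^2].  The metric is the pairing of [p] with [q] (up to a factor), and [J]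
    fixes [p] and negates [q].  Let [i] be the rotation of [R^2] by a right
    angle.  A null vector with [p <> 0] satisfies [q = lam i p] for one number
    [lam], its slope.  The vectors [q = lam i p] fill a null plane [P_lam], and
    [J P_lam = P_(-lam)].  If [a] and [b] are the two null directions of an
    indefinite Lagrangian plane, then [<a, b> <> 0] and [omega (a, b) = 0] force
    their slopes to be nonzero and opposite ([null_planes_of_pair]): the plane is
    the sum of a line of [P_lam] and a line of [J P_lam].

    On a minimal surface [lam] is locally constant.  For an orthonormal frame
    [E1, E2], of signs [s1] and [- s1], the null fields are [a = E1 + E2] and
    [b = E1 - E2].  Vanishing of the mean curvature says that
    [D_E1 E1 - D_E2 E2] is tangent; [D_E1 E2 - D_E2 E1] is tangent because second
    derivatives commute ([push_commutator]); hence so are [D_b a] and [D_a b]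
    ([minimal_null_derivatives]).  Differentiate [q(a) = lam i p(a)] along [b],
    knowing that [D_b a = x a + y b] with [a] of slope [lam] and [b] of slope
    [- lam]: what is left is [D_b lam = 0] ([derive_null_plane_slope0]), and
    exchanging the two fields gives [D_a lam = 0].  So near each point one plane
    [P = P_lam] serves all tangent planes.

    Decompose the parametrization [phi] along [D^2 = P + J P].  Its
    [P]-component is killed by [b] and its [J P]-component by [a].  Take a linear
    form on each component that does not vanish on [a], resp. on [b], at the given
    point; composed with [phi] they give functions [u] and [v] for which suitable
    multiples of the parameter fields of [a] and [b] are a dual frame.  They are
    therefore local coordinates ([inverse_chart_exists]), in which the
    [P]-component depends on [u] only and the [J P]-component on [v] only: these
    are [gamma1] and [J gamma2].  As [u] and [v] come from linear forms of the
    ambient space, the new parametrization has a linear left inverse, whence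
    regularity, injectivity and openness ([local_param_section]).

    The inverse function theorem needed here is proved for two functions on the
    plane with a dual frame [X, Y].  Strict differentiability makes the inverse
    Lipschitz, and values near [(u q, v q)] are attained where
    [(u - s)^2 + (v - t)^2] is minimal.  Higher smoothness needs no further
    induction on the inverse: along a coordinate line a function [F] has
    derivative [D_X F], which is again a smooth function evaluated on that line
    ([smooth_integral_curve]). *)

(** * Smooth maps *)

Lemma near_eq_differentiable (R : realType) (V W : normedModType R)
    (f g : V -> W) (x : V) :
  (\near x, f x = g x) -> differentiable f x -> differentiable g x.
Proof.
move=> fg df.
have H : g \o shift x = cst (g x) + 'd f x +o_ 0 id.
  apply/eqaddoP => e e0.
  have /eqaddoP/(_ e e0) := diff_locally df.
  have fgx := nbhs_singleton fg.
  have : \forall h \near (0 : V), f (h + x) = g (h + x).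
    by have := fg; rewrite (near_shift 0)/= subr0.
  move=> fgh dfh; apply: filterS2 fgh dfh => h /= fgh.
  by rewrite !fctE /= fgx fgh.
have dg := diff_unique (diff_continuous df) H.
by apply/diff_locallyP; split; rewrite dg; [exact: diff_continuous|exact: H].
Qed.

Section SmoothCalculus.
Variable R : realType.
Implicit Types V W Z : normedModType R.

Lemma derive_linear_comp V W Z (f : V -> W) (l : {linear W -> Z}) x v :
  continuous l -> differentiable f x -> 'D_v (l \o f) x = l ('D_v f x).
Proof.
move=> cl df; have dl y : differentiable l y by exact: linear_differentiable.
rewrite !deriveE//; last exact: differentiable_comp.
by rewrite diff_comp//= diff_lin.
Qed.

Lemma derive_comp_linear V W Z (f : W -> Z) (l : {linear V -> W}) x v :
  continuous l -> differentiable f (l x) -> 'D_v (f \o l) x = 'D_(l v) f (l x).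
Proof.
move=> cl df; have dl y : differentiable l y by exact: linear_differentiable.
rewrite !deriveE//; last exact: differentiable_comp.
by rewrite diff_comp//= diff_lin.
Qed.

(** [Cn_on] looks at the values on [U] only, so identities between
    derivatives that hold just on [U] can be used under it. *)
Lemma Cn_on_eq V W n (U : set V) (f g : V -> W) :
  open U -> (forall x, U x -> f x = g x) -> Cn_on n U f -> Cn_on n U g.
Proof.
move=> oU; elim: n f g => [|n IH] f g fg.
  move=> cf x Ux; have nfg : \near x, f x = g x.
    by near=> y; apply: fg; near: y; exact: open_nbhs_nbhs.
  rewrite /prop_for /continuous_at -(fg x Ux).
  apply: cvg_trans (cf x Ux); apply: near_eq_cvg.
  by apply: filterS nfg => y ->.
have nfg x : U x -> \near x, f x = g x.
  by move=> Ux; near=> y; apply: fg; near: y; exact: open_nbhs_nbhs.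
move=> [df Df]; split=> [x Ux|v].
  by apply: near_eq_differentiable (df x Ux); exact: nfg.
by apply: IH (Df v) => x Ux; apply: near_eq_derive; exact: nfg.
Unshelve. all: by end_near. Qed.

Lemma Cn_on_subset V W n (U U' : set V) (f : V -> W) :
  U' `<=` U -> Cn_on n U f -> Cn_on n U' f.
Proof.
move=> sU; elim: n f => [|n IH] f; first by move=> cf x /sU; exact: cf.
by move=> [df Df]; split=> [x Ux|v]; [exact/df/sU|exact/IH/Df].
Qed.

Lemma Cn_on_pred V W n (U : set V) (f : V -> W) :
  Cn_on n.+1 U f -> Cn_on n U f.
Proof.
elim: n f => [|n IH] f [df Df].
  by move=> x Ux; apply: differentiable_continuous; exact: df.
by split=> // v; exact/IH/Df.
Qed.

Lemma Cn_on_cst V W n (U : set V) (c : W) : Cn_on n U (cst c).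
Proof.
elim: n c => [|n IH] c; first by move=> x _; exact: cst_continuous.
split=> [x _|v]; first exact: differentiable_cst.
have -> : (fun x => 'D_v (cst c) x) = cst 0 :> (V -> W).
  by apply/funext => x; rewrite derive_cst.
exact: IH.
Qed.

Lemma Cn_on_add V W n (U : set V) (f g : V -> W) : open U ->
  Cn_on n U f -> Cn_on n U g -> Cn_on n U (f + g).
Proof.
move=> oU; elim: n f g => [|n IH] f g.
  by move=> cf cg x Ux; apply: continuousD; [exact: cf|exact: cg].
move=> [df Df] [dg Dg]; split=> [x Ux|v].
  by apply: differentiableD; [exact: df|exact: dg].
apply: Cn_on_eq (IH _ _ (Df v) (Dg v)) => // x Ux.
by rewrite deriveD//; apply: diff_derivable; [exact: df|exact: dg].
Qed.

Lemma Cn_on_linear_comp V W Z n (U : set V) (l : {linear W -> Z}) (f : V -> W) :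
  open U -> continuous l -> Cn_on n U f -> Cn_on n U (l \o f).
Proof.
move=> oU cl; elim: n f => [|n IH] f.
  by move=> cf x Ux; apply: continuous_comp; [exact: cf|exact: cl].
move=> [df Df]; split=> [x Ux|v].
  by apply: differentiable_comp; [exact: df|exact: linear_differentiable].
by apply: Cn_on_eq (IH _ (Df v)) => // x Ux; rewrite derive_linear_comp//; exact: df.
Qed.

Lemma Cn_on_comp_linear V W Z n (U : set W) (l : {linear V -> W}) (f : W -> Z) :
  open U -> continuous l -> Cn_on n U f -> Cn_on n (l @^-1` U) (f \o l).
Proof.
move=> oU cl; have oP : open (l @^-1` U) by apply: open_comp => // x _; exact: cl.
elim: n f => [|n IH] f.
  by move=> cf x Ux; apply: continuous_comp; [exact: cl|exact: cf].
move=> [df Df]; split=> [x Ux|v].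
  by apply: differentiable_comp; [exact: linear_differentiable|exact: df].
by apply: Cn_on_eq (IH _ (Df (l v))) => // x Ux; rewrite derive_comp_linear//; exact: df.
Qed.

Lemma Cn_on_mul V n (U : set V) (f g : V -> R) : open U ->
  Cn_on n U f -> Cn_on n U g -> Cn_on n U (f * g).
Proof.
move=> oU; elim: n f g => [|n IH] f g.
  by move=> cf cg x Ux; apply: continuousM; [exact: cf|exact: cg].
move=> Cf Cg; have := Cn_on_pred Cf; have := Cn_on_pred Cg.
case: Cf Cg => [df Df] [dg Dg] Cg Cf; split=> [x Ux|v].
  by apply: differentiableM; [exact: df|exact: dg].
apply: Cn_on_eq (Cn_on_add oU (IH _ _ Cf (Dg v)) (IH _ _ Cg (Df v))) => // x Ux.
by rewrite deriveM//; apply: diff_derivable; [exact: df|exact: dg].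
Qed.

Lemma Cn_on_inv V n (U : set V) (f : V -> R) : open U ->
  (forall x, U x -> f x != 0) -> Cn_on n U f -> Cn_on n U (fun x => (f x)^-1).
Proof.
move=> oU f0; elim: n => [|n IH].
  by move=> cf x Ux; apply: continuousV; [exact: f0|exact: cf].
move=> Cf; have Ci := IH (Cn_on_pred Cf); case: Cf => [df Df]; split=> [x Ux|v].
  by apply: differentiableV; [exact: df|exact: f0].
have C1 := Cn_on_mul oU (Cn_on_mul oU Ci Ci) (Df v).
apply: Cn_on_eq (Cn_on_mul oU (Cn_on_cst n U (-1 : R)) C1) => // x Ux.
rewrite deriveV//; [|exact: f0|by apply: diff_derivable; exact: df].
by rewrite !fctE /= expr2 invfM mulN1r scaleNr.
Qed.

Lemma deriveZdir V W (F : V -> W) x v (h : R) : differentiable F x ->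
  'D_(h *: v) F x = h *: 'D_v F x.
Proof. by move=> dF; rewrite !deriveE// linearZ. Qed.

Lemma derive_dirD (V W : normedModType R) (f : V -> W) (x v w : V) :
  differentiable f x -> 'D_(v + w) f x = 'D_v f x + 'D_w f x.
Proof.
move=> df; have Ev := deriveE v df; have Ew := deriveE w df.
by rewrite Ev Ew (deriveE (v + w) df) linearD.
Qed.

Lemma derive_dirB (V W : normedModType R) (f : V -> W) (x v w : V) :
  differentiable f x -> 'D_(v - w) f x = 'D_v f x - 'D_w f x.
Proof.
move=> df; have Ev := deriveE v df; have Ew := deriveE w df.
by rewrite Ev Ew (deriveE (v - w) df) linearB.
Qed.

Lemma smooth_on_linear_comp (V W Z : normedModType R) (U : set V) (l : {linear W -> Z})
  (f : V -> W) : open U -> continuous l -> smooth_on U f -> smooth_on U (l \o f).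
Proof. by move=> oU cl Cf n; exact: Cn_on_linear_comp. Qed.

Lemma smooth_on_add (V W : normedModType R) (U : set V) (f g : V -> W) :
  open U -> smooth_on U f -> smooth_on U g -> smooth_on U (f + g).
Proof. by move=> oU Cf Cg n; exact: Cn_on_add. Qed.

Lemma smooth_on_sub (V W : normedModType R) (U : set V) (f g : V -> W) :
  open U -> smooth_on U f -> smooth_on U g -> smooth_on U (f - g).
Proof.
move=> oU Cf Cg; apply: smooth_on_add => //.
have cN : continuous (-%R : W -> W) by exact: opp_continuous.
exact: (@smooth_on_linear_comp _ _ _ _ (-%R : {linear W -> W}) g).
Qed.

Lemma continuous_fst_pair (V W : normedModType R) : continuous (@fst V W).
Proof. by move=> x; exact: cvg_fst. Qed.

Lemma continuous_snd_pair (V W : normedModType R) : continuous (@snd V W).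
Proof. by move=> x; exact: cvg_snd. Qed.

End SmoothCalculus.

Section LinearMaps.
Variable R : realType.
Local Notation D2 := (paracomplex2 R).

Lemma linear_plane_continuous (W : normedModType R) (f : {linear (R * R)%type -> W}) :
  continuous f.
Proof.
have -> : (f : R * R -> W) = (fun z => z.1 *: f (1, 0) + z.2 *: f (0, 1)).
  apply/funext => -[a b] /=; rewrite -!linearZ -linearD; congr (f (_, _)) => /=.
    by rewrite [a *: 1]mulr1 [b *: 0]mulr0 addr0.
  by rewrite [a *: 0]mulr0 [b *: 1]mulr1 add0r.
have C1 : continuous (( *:%R^~ (f (1, 0))) \o @fst R R).
  move=> z; apply: continuous_comp.
    exact: cvg_fst.
  exact: scalel_continuous.
have C2 : continuous (( *:%R^~ (f (0, 1))) \o @snd R R).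
  move=> z; apply: continuous_comp.
    exact: cvg_snd.
  exact: scalel_continuous.
by move=> z; exact: continuousD (C1 z) (C2 z).
Qed.

Definition inl_pair (V W : lmodType R) (v : V) : V * W := (v, 0).
Definition inr_pair (V W : lmodType R) (w : W) : V * W := (0, w).

Fact inl_pair_linear V W : linear (@inl_pair V W).
Proof. by move=> a v w; rewrite /inl_pair; congr (_, _); rewrite /= scaler0 addr0. Qed.
Fact inr_pair_linear V W : linear (@inr_pair V W).
Proof. by move=> a v w; rewrite /inr_pair; congr (_, _); rewrite /= scaler0 addr0. Qed.
HB.instance Definition _ (V W : lmodType R) :=
  GRing.isLinear.Build R V (V * W)%type *:%R (@inl_pair V W) (@inl_pair_linear V W).
HB.instance Definition _ (V W : lmodType R) :=
  GRing.isLinear.Build R W (V * W)%type *:%R (@inr_pair V W) (@inr_pair_linear V W).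

Lemma linear_paracomplex2_continuous (W : normedModType R) (f : {linear D2 -> W}) :
  continuous f.
Proof.
have -> : (f : D2 -> W) =
    (fun z => (f \o @inl_pair (R * R)%type (R * R)%type) z.1 +
              (f \o @inr_pair (R * R)%type (R * R)%type) z.2).
  apply/funext => -[a b] /=; rewrite -linearD; congr (f (_, _)) => /=.
    by rewrite addr0.
  by rewrite add0r.
have C1 : continuous ((f \o @inl_pair (R * R)%type (R * R)%type) \o @fst (R * R)%type (R * R)%type).
  move=> z; apply: continuous_comp.
    exact: cvg_fst.
  exact: linear_plane_continuous.
have C2 : continuous ((f \o @inr_pair (R * R)%type (R * R)%type) \o @snd (R * R)%type (R * R)%type).
  move=> z; apply: continuous_comp.
    exact: cvg_snd.
  exact: linear_plane_continuous.
by move=> z; exact: continuousD (C1 z) (C2 z).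
Qed.

Lemma Cn_on_pair (V W Z : normedModType R) n (U : set V) (f : V -> W) (g : V -> Z) :
  open U -> Cn_on n U f -> Cn_on n U g -> Cn_on n U (fun x => (f x, g x)).
Proof.
move=> oU Cf Cg.
have cl : continuous (@inl_pair W Z).
  by move=> w; apply: cvg_pair; [exact: cvg_id|exact: cvg_cst].
have cr : continuous (@inr_pair W Z).
  by move=> z; apply: cvg_pair; [exact: cvg_cst|exact: cvg_id].
apply: Cn_on_eq (Cn_on_add oU (Cn_on_linear_comp oU cl Cf) (Cn_on_linear_comp oU cr Cg)) => // x Ux.
by congr (_, _); rewrite /= ?addr0 ?add0r.
Qed.
End LinearMaps.

(** * Mean values and the symmetry of second derivatives *)

Section MeanValue.
Variable R : realType.
Implicit Types V W : normedModType R.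

Lemma is_derive_line V W (F : V -> W) (x v : V) (t : R) :
  differentiable F (x + t *: v) ->
  is_derive t 1 (fun s : R => F (x + s *: v)) ('D_v F (x + t *: v)).
Proof.
move=> dF; have dFv := @diff_derivable _ _ _ _ _ v dF.
have E : (fun h : R => h^-1 *: (F (h *: v + (x + t *: v)) - F (x + t *: v))) =
   (fun h : R => h^-1 *: (F (x + (h *: (1 : R) + t) *: v) - F (x + t *: v))).
  by apply/funext => h; rewrite scalerDl [h *: 1]mulr1 addrCA.
by apply: DeriveDef; [move: dFv; rewrite /derivable E|rewrite /derive E].
Qed.

Lemma line_mean_value V (F : V -> R) (x v : V) :
  (forall t : R, 0 <= t <= 1 -> differentiable F (x + t *: v)) ->
  exists2 t : R, 0 < t < 1 & F (x + v) - F x = 'D_v F (x + t *: v).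
Proof.
move=> dF; have D (t : R) : 0 <= t <= 1 -> is_derive t 1 (fun s : R => F (x + s *: v))
    ('D_v F (x + t *: v)) by move=> /dF; exact: is_derive_line.
have [|t||t] := @MVT R (fun s : R => F (x + s *: v))
  (fun s => 'D_v F (x + s *: v)) 0 1.
- exact: ltr01.
- by rewrite in_itv/= => /andP[t0 t1]; apply: D; rewrite !ltW.
- apply: derivable_within_continuous => t; rewrite in_itv/= => t01.
  by have [] := D t t01.
rewrite in_itv/= => t01; rewrite scale1r scale0r addr0 subr0 mulr1 => E.
by exists t.
Qed.

(** The second difference is symmetric in [u] and [v], while the two
    mean value steps below treat them in a fixed order: comparing both orders
    is what makes mixed derivatives agree. *)
Lemma second_difference V (U : set V) (F : V -> R) (q u v : V) :
  open U -> Cn_on 2 U F ->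
  (forall s t : R, 0 <= s <= 1 -> 0 <= t <= 1 -> U (q + s *: u + t *: v)) ->
  exists s t : R, [/\ 0 <= s <= 1, 0 <= t <= 1 &
    F (q + u + v) - F (q + u) - F (q + v) + F q =
    'D_u (fun x => 'D_v F x) (q + s *: u + t *: v)].
Proof.
move=> oU [dF D2F] Uq; have [dDF _] := D2F v.
have I1 : 0 <= (1 : R) <= 1 by rewrite ler01 lexx.
have I0 : 0 <= (0 : R) <= 1 by rewrite lexx ler01.
pose G := (fun x => F (x + u)) - F.
have dT (y : V) : differentiable (fun x : V => x + u) y.
  by apply: differentiableD => //; exact: differentiable_cst.
have dFu y : U (y + u) -> differentiable (fun x => F (x + u)) y.
  by move=> Uy; apply: (@differentiable_comp _ _ _ _ (fun x => x + u)) => //; exact: dF.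
have DFu y : U (y + u) -> 'D_v (fun x => F (x + u)) y = 'D_v F (y + u).
  move=> Uy; rewrite !deriveE//; [|exact: dF|exact: dFu].
  rewrite (@diff_comp _ _ _ _ (fun x => x + u) F)//=; last exact: dF.
  congr ('d F _ _); rewrite (@diffD _ _ _ id (cst u))//; first last.
  by rewrite diff_cst diff_val /= addr0.
have [t t01 Et] : exists2 t : R, 0 < t < 1 & G (q + v) - G q = 'D_v G (q + t *: v).
  apply: line_mean_value => t t01; apply: differentiableB.
    by apply: dFu; rewrite -[u in X in U X]scale1r addrAC; exact: Uq.
  by apply: dF; have := Uq 0 t I0 t01; rewrite scale0r addr0.
have {}t01 : 0 <= t <= 1 by case/andP: t01 => ? ?; rewrite !ltW.
have U1 : U (q + t *: v + u) by rewrite -[u in X in U X]scale1r addrAC; exact: Uq.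
have U2 : U (q + t *: v) by have := Uq 0 t I0 t01; rewrite scale0r addr0.
have EG : 'D_v G (q + t *: v) = 'D_v F (q + t *: v + u) - 'D_v F (q + t *: v).
  by rewrite deriveB ?DFu//; apply: diff_derivable; [exact: dFu|exact: dF].
have [s s01 Es] : exists2 s : R, 0 < s < 1 &
    'D_v F (q + t *: v + u) - 'D_v F (q + t *: v) =
    'D_u (fun x => 'D_v F x) (q + t *: v + s *: u).
  apply: (@line_mean_value _ (fun x => 'D_v F x)) => s s01; apply: dDF.
  by rewrite addrAC; exact: Uq.
have {}s01 : 0 <= s <= 1 by case/andP: s01 => ? ?; rewrite !ltW.
exists s, t; split; [exact: s01|exact: t01|].
rewrite [in RHS]addrAC -Es -EG -Et /G !fctE [q + u + v]addrAC; ring.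
Qed.

(** Lets [second_difference] be used for [h u] and [h v] with all
    intermediate points in a prescribed neighbourhood of [q]. *)
Lemma small_parallelogram V (P : set V) (q u v : V) : (\near q, P q) ->
  exists2 h : R, 0 < h & forall s t : R, 0 <= s <= 1 -> 0 <= t <= 1 ->
    P (q + s *: (h *: u) + t *: (h *: v)).
Proof.
move=> /nbhs_ballP[r /= r0 rP].
have [h h0 hr] : exists2 h : R, 0 < h & h * (`|u| + `|v|) < r.
  have N0 : 0 < `|u| + `|v| + 1 by rewrite ltr_pwDr// addr_ge0.
  exists (r / (`|u| + `|v| + 1)); first by rewrite divr_gt0.
  by rewrite mulrAC ltr_pdivrMr// ltr_pM2l// ltrDl.
exists h => // s t /andP[s0 s1] /andP[t0 t1]; apply: rP; rewrite -ball_normE /=.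
rewrite -addrA opprD addNKr normrN !scalerA.
apply: le_lt_trans hr; apply: le_trans (ler_normD _ _) _;
  rewrite (normrZ (s * h) u) (normrZ (t * h) v) mulrDr.
by apply: lerD; apply: ler_wpM2r => //;
  rewrite normrM (gtr0_norm h0) ger0_norm// ler_piMl// ltW.
Qed.

Lemma dist_le_of_common (a b c e : R) :
  `|a - c| < e / 2 -> `|b - c| < e / 2 -> `|a - b| <= e.
Proof.
rewrite !ltr_distl => /andP[ac ca] /andP[bc cb].
by rewrite ler_distl; apply/andP; split; lra.
Qed.

(** On a small parallelogram the second difference is [h^2] times
    [D_u D_v F] at one point and [h^2] times [D_v D_u F] at another; both
    points tend to [q]. *)
Theorem derive_symmetric V (U : set V) (F : V -> R) (q u v : V) :
  open U -> U q -> Cn_on 2 U F ->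
  'D_u (fun x => 'D_v F x) q = 'D_v (fun x => 'D_u F x) q.
Proof.
move=> oU Uq C2; have [dF D2F] := C2; have [dDu /(_ v) cvu] := D2F u.
have [dDv /(_ u) cuv] := D2F v.
have DD a b (h : R) x : U x -> differentiable (fun x => 'D_b F x) x ->
    'D_(h *: a) (fun x => 'D_(h *: b) F x) x = h * h * 'D_a (fun x => 'D_b F x) x.
  move=> Ux dD; rewrite (@near_eq_derive _ _ _ _ (h \*: (fun x => 'D_b F x))).
    rewrite deriveZ; last exact: diff_derivable.
    by rewrite deriveZdir// scalerA.
  by near=> y; rewrite deriveZdir//; apply: dF; near: y; exact: open_nbhs_nbhs.
apply/eqP; rewrite -subr_eq0 -normr_eq0 eq_le normr_ge0 andbT.
apply/ler_addgt0Pr => e e0; rewrite add0r.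
have e2 : 0 < e / 2 by rewrite divr_gt0.
pose P := fun x =>
  [/\ U x, `|'D_u (fun x => 'D_v F x) q - 'D_u (fun x => 'D_v F x) x| < e / 2
     & `|'D_v (fun x => 'D_u F x) q - 'D_v (fun x => 'D_u F x) x| < e / 2].
have nP : \near q, P q.
  have /cvgrPdist_lt/(_ _ e2) nuv := cuv q Uq.
  have /cvgrPdist_lt/(_ _ e2) nvu := cvu q Uq.
  have nU : \near q, U q by exact: open_nbhs_nbhs.
  apply: filterS (filterI nU (filterI nuv nvu)) => x.
  move=> [Ux [xu xv]].
  exact: And3 Ux xu xv.
have [h h0 hP] := small_parallelogram u v nP.
have [|s [t [s01 t01 E1]]] := @second_difference _ U F q (h *: u) (h *: v) oU C2.
  by move=> s t s01 t01; have [] := hP s t s01 t01.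
have [|t' [s' [t01' s01' E2]]] := @second_difference _ U F q (h *: v) (h *: u) oU C2.
  by move=> t' s' ? ?; rewrite addrAC; have [] := hP s' t'.
have [Ux dx _] := hP s t s01 t01; have [Uy _ dy] := hP s' t' s01' t01'.
move: E2; rewrite (addrAC q (h *: v)) (addrAC q (t' *: _)).
rewrite (DD v u h _ Uy (dDu _ Uy)) (addrAC _ (- F (q + h *: v))).
rewrite {}E1 (DD u v h _ Ux (dDv _ Ux)).
have hh0 : h * h != 0 by rewrite mulf_neq0 ?gt_eqF.
move=> /(mulfI hh0) E.
rewrite E in dx; exact: dist_le_of_common dx dy.
Unshelve. all: by end_near. Qed.

Lemma segment_ball (V : normedModType R) (q x y : V) (r t : R) :
  ball q r x -> ball q r y -> 0 <= t <= 1 -> ball q r (y + t *: (x - y)).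
Proof.
rewrite -ball_normE /= => qx qy /andP[t0 t1].
have -> : q - (y + t *: (x - y)) = (1 - t) *: (q - y) + t *: (q - x).
  rewrite scalerBl scale1r -[RHS]addrA -scalerN -scalerDr opprB subrKA.
  by rewrite opprD addrA -scalerN opprB.
apply: le_lt_trans (ler_normD _ _) _; rewrite !normrZ.
rewrite ger0_norm ?subr_ge0// (ger0_norm t0).
move: `|q - x| `|q - y| qx qy => a b ar br.
by have [ab|ba] := leP a b; nra.
Qed.

Lemma derive0_constant_ball (V : normedModType R) (f : V -> R) (q x : V) (r : R) :
  0 < r -> (forall y : V, ball q r y -> differentiable f y /\ forall w, 'D_w f y = 0) ->
  ball q r x -> f x = f q.
Proof.
move=> r0 H qx; have qq : ball q r q by exact: ballxx.
have df (t : R) : 0 <= t <= 1 -> differentiable f (q + t *: (x - q)).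
  by move=> t01; have [] := H _ (segment_ball qx qq t01).
have [t t01 E] := line_mean_value df.
have {}t01 : 0 <= t <= 1 by case/andP: t01 => ? ?; rewrite !ltW.
have [_ D0] := H _ (segment_ball qx qq t01).
by apply/eqP; rewrite -subr_eq0 -[x in f x](subrKC q) E D0.
Qed.

Lemma derive0_constant (I : set R) (f : R -> R) (s t : R) : is_interval I ->
  (forall x : R, I x -> is_derive x 1 f 0) -> I s -> I t -> f s = f t.
Proof.
move=> iI D Is It.
have Imid c : 0 <= c <= 1 -> I (t + c *: (s - t)).
  move=> /andP[c0 c1]; rewrite /GRing.scale /=.
  have [st|ts] := leP s t.
    by apply: (iI _ _ Is It); apply/andP; split; nra.
  by apply: (iI _ _ It Is); apply/andP; split; nra.
have df c : 0 <= c <= 1 -> differentiable f (t + c *: (s - t)).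
  by move=> /Imid/D[? _]; apply/derivable1_diffP.
have [c c01 E] := line_mean_value df.
have {}c01 : 0 <= c <= 1 by case/andP: c01 => ? ?; rewrite !ltW.
apply/eqP; rewrite -subr_eq0 -[s in f s](subrK t) addrC; apply/eqP.
rewrite [s - t + t]addrC [- _ + _]addrC E.
rewrite -[X in 'D_X _ _]mulr1 -[(s - t) * 1]/((s - t) *: 1) deriveZdir; last exact: df.
by have [_ ->] := D _ (Imid c c01); rewrite scaler0.
Qed.

End MeanValue.

(** * Local inverses in the plane *)

Section Plane.
Variable R : realType.
Implicit Types (U : set (R * R)) (x y q w : R * R).

Lemma derive_partials (W : normedModType R) (F : R * R -> W) x w :
  differentiable F x ->
  'D_w F x = w.1 *: 'D_(1, 0) F x + w.2 *: 'D_(0, 1) F x.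
Proof.
move=> dF; rewrite !deriveE// -!linearZ -linearD; congr ('d F x _).
case: w => a b; congr (_, _) => /=.
  by rewrite [a *: 1]mulr1 [b *: 0]mulr0 addr0.
by rewrite [a *: 0]mulr0 [b *: 1]mulr1 add0r.
Qed.

(** The mean value theorem on the segment from [y] to [x],
    where the partial derivatives are within [e / 2] of those at [q]. *)
Lemma strictly_differentiable U (F : R * R -> R) q (e : R) :
  open U -> U q -> Cn_on 1 U F -> 0 < e ->
  exists2 r : R, 0 < r & ball q r `<=` U /\
    forall x y, ball q r x -> ball q r y ->
      `|F x - F y - 'D_(x - y) F q| <= e * `|x - y|.
Proof.
move=> oU Uq [dF DF] e0; have e2 : 0 < e / 2 by rewrite divr_gt0.
have /cvgrPdist_lt/(_ _ e2) n1 := DF (1, 0) q Uq.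
have /cvgrPdist_lt/(_ _ e2) n2 := DF (0, 1) q Uq.
have nU : \near q, U q by exact: open_nbhs_nbhs.
have [r /= r0 rP] := (nbhs_ballP _ _).1 (filterI nU (filterI n1 n2)).
exists r => //; split=> [x /rP[]//|x y qx qy].
have [t t01|t t01 Et] := @line_mean_value _ _ F y (x - y).
  by apply: dF; have [] := rP _ (segment_ball qx qy t01).
have {}t01 : 0 <= t <= 1 by case/andP: t01 => ? ?; rewrite !ltW.
have [Uz [z1 z2]] := rP _ (segment_ball qx qy t01).
rewrite (addrC y (x - y)) subrK in Et; rewrite Et.
rewrite (derive_partials _ (dF _ Uz)) (derive_partials _ (dF _ Uq)).
move: z1 z2; set z := y + _; set w := x - y.
move: ('D_(1, 0) F z) ('D_(0, 1) F z) ('D_(1, 0) F q) ('D_(0, 1) F q).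
move=> a b c d ca db.
have -> : w.1 *: a + w.2 *: b - (w.1 *: c + w.2 *: d) =
  w.1 * (a - c) + w.2 * (b - d) by rewrite /GRing.scale /=; ring.
apply: le_trans (ler_normD _ _) _; rewrite !normrM.
rewrite distrC in ca; rewrite distrC in db.
have : `|w.1| <= `|w| /\ `|w.2| <= `|w|.
  by rewrite prod_normE !le_max !lexx orbT.
move: (normr_ge0 w.1) (normr_ge0 w.2) (normr_ge0 (a - c)) (normr_ge0 (b - d)).
move: `|a - c| `|b - d| `|w| `|w.1| `|w.2| ca db => A B n n1' n2' ca db.
by move=> ? ? ? ? [? ?]; nra.
Qed.

End Plane.

Section LocalInverse.
Variable R : realType.
Implicit Types (U : set (R * R)) (x y q w : R * R).

(** Invertibility of the differential of [(u, v)], with the columns of the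
    inverse matrix given as vector fields. *)
Definition dual_frame U (u v : R * R -> R) (X Y : R * R -> R * R) :=
  forall x, U x -> ('D_(X x) u x = 1 /\ 'D_(X x) v x = 0) /\
                   ('D_(Y x) u x = 0 /\ 'D_(Y x) v x = 1).

(** A right inverse of a square matrix is a left inverse: the first
    four equations say that the matrix of rows [(u1, u2)], [(v1, v2)] times that of
    columns [(a, b)], [(c, d)] is the identity. *)
Lemma dual_basis_expand (u1 u2 v1 v2 a b c d : R) :
  a * u1 + b * u2 = 1 -> a * v1 + b * v2 = 0 ->
  c * u1 + d * u2 = 0 -> c * v1 + d * v2 = 1 ->
  forall w1 w2 : R, (w1 * u1 + w2 * u2) * a + (w1 * v1 + w2 * v2) * c = w1 /\
                    (w1 * u1 + w2 * u2) * b + (w1 * v1 + w2 * v2) * d = w2.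
Proof.
move=> ux vx uy vy w1 w2; pose D := a * d - b * c.
have D1 : D * (u1 * v2 - u2 * v1) = 1.
  have -> : D * (u1 * v2 - u2 * v1) =
    (a * u1 + b * u2) * (c * v1 + d * v2) - (a * v1 + b * v2) * (c * u1 + d * u2).
    by rewrite /D; ring.
  by rewrite ux vy vx mul0r subr0 mulr1.
have D0 : D != 0 by apply/eqP => D0; move: D1; rewrite D0 mul0r => /eqP; rewrite eq_sym oner_eq0.
have Du1 : D * u1 = d.
  have -> : D * u1 = d * (a * u1 + b * u2) - b * (c * u1 + d * u2) by rewrite /D; ring.
  by rewrite ux uy; ring.
have Du2 : D * u2 = - c.
  have -> : D * u2 = a * (c * u1 + d * u2) - c * (a * u1 + b * u2) by rewrite /D; ring.
  by rewrite ux uy; ring.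
have Dv1 : D * v1 = - b.
  have -> : D * v1 = d * (a * v1 + b * v2) - b * (c * v1 + d * v2) by rewrite /D; ring.
  by rewrite vx vy; ring.
have Dv2 : D * v2 = a.
  have -> : D * v2 = a * (c * v1 + d * v2) - c * (a * v1 + b * v2) by rewrite /D; ring.
  by rewrite vx vy; ring.
split; apply: (mulfI D0).
  have -> : D * ((w1 * u1 + w2 * u2) * a + (w1 * v1 + w2 * v2) * c) =
   (w1 * (D * u1) + w2 * (D * u2)) * a + (w1 * (D * v1) + w2 * (D * v2)) * c by ring.
  by rewrite Du1 Du2 Dv1 Dv2 /D; ring.
have -> : D * ((w1 * u1 + w2 * u2) * b + (w1 * v1 + w2 * v2) * d) =
   (w1 * (D * u1) + w2 * (D * u2)) * b + (w1 * (D * v1) + w2 * (D * v2)) * d by ring.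
by rewrite Du1 Du2 Dv1 Dv2 /D; ring.
Qed.

Lemma norm_lt_of_square (z d : R) :
  0 < d -> z * z <= 2 * (d * d) -> `|z| < 2 * d.
Proof.
move=> d0 zd; rewrite ltr_norml; apply/andP; split; rewrite ltNge; apply/negP => h.
  by have : (2 * d) * (2 * d) <= z * z; nra.
by have : (2 * d) * (2 * d) <= z * z; nra.
Qed.

Lemma norm_le_of_dist (a b c : R) : `|a - b| <= c -> `|b| <= `|a| + c.
Proof.
move=> abc; rewrite -{1}[b](subKr a); apply: le_trans (ler_normB _ _) _.
by rewrite lerD2l.
Qed.

Variables (U : set (R * R)) (u v : R * R -> R) (X Y : R * R -> R * R).
Hypotheses (oU : open U) (Cu : Cn_on 1 U u) (Cv : Cn_on 1 U v).
Hypothesis frame : dual_frame U u v X Y.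

Lemma dual_frame_expand x w : U x ->
  w = 'D_w u x *: X x + 'D_w v x *: Y x.
Proof.
move=> Ux; have [du _] := Cu; have [dv _] := Cv.
have [[]] := frame Ux.
rewrite (derive_partials (X x) (du _ Ux)) (derive_partials (Y x) (du _ Ux)).
rewrite (derive_partials (X x) (dv _ Ux)) (derive_partials (Y x) (dv _ Ux)).
rewrite (derive_partials w (du _ Ux)) (derive_partials w (dv _ Ux)).
rewrite /GRing.scale /= => ux vx [uy vy].
have [E1 E2] := dual_basis_expand ux vx uy vy w.1 w.2.
by case: w E1 E2 => w1 w2 /= E1 E2; congr (_, _); rewrite /= ?E1 ?E2.
Qed.

(** By [dual_frame_expand], [x - y] is bounded by its derivatives
    [D_(x - y) u] and [D_(x - y) v] at [q]; strict differentiability replaces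
    them by the increments of [u] and [v] up to half of [|x - y|], which is
    absorbed. *)
Lemma inverse_lipschitz q : U q -> exists r K : R,
  [/\ 0 < r, 0 < K, ball q r `<=` U &
  forall x y, ball q r x -> ball q r y ->
    `|x - y| <= K * (`|u x - u y| + `|v x - v y|)].
Proof.
move=> Uq; pose C := `|X q| + `|Y q| + 1.
have C0 : 0 < C by rewrite ltr_pwDr// addr_ge0.
have e0 : 0 < (4 * C)^-1 by rewrite invr_gt0 mulr_gt0.
have [r1 r10 [sU1 H1]] := strictly_differentiable oU Uq Cu e0.
have [r2 r20 [_ H2]] := strictly_differentiable oU Uq Cv e0.
(* with [e = 1 / (4 C)] the two error terms add up to half of [|x - y|] *)
exists (Num.min r1 r2), (2 * C); split.
- by rewrite lt_min r10 r20.
- by rewrite mulr_gt0.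
- by move=> x qx; apply: sU1; apply: le_ball qx; rewrite ge_min lexx.
move=> x y qx qy.
have L1 : Num.min r1 r2 <= r1 by rewrite ge_min lexx.
have L2 : Num.min r1 r2 <= r2 by rewrite ge_min lexx orbT.
have {}H1 := H1 x y (le_ball L1 qx) (le_ball L1 qy).
have {}H2 := H2 x y (le_ball L2 qx) (le_ball L2 qy).
have Ew := dual_frame_expand (x - y) Uq.
have : `|x - y| <= `|'D_(x - y) u q| * `|X q| + `|'D_(x - y) v q| * `|Y q|.
  by rewrite {1}Ew; apply: le_trans (ler_normD _ _) _; rewrite !normrZ.
have {}H1 : `|'D_(x - y) u q| <= `|u x - u y| + (4 * C)^-1 * `|x - y|.
  exact: norm_le_of_dist.
have {}H2 : `|'D_(x - y) v q| <= `|v x - v y| + (4 * C)^-1 * `|x - y|.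
  exact: norm_le_of_dist.
have : `|X q| <= C /\ `|Y q| <= C.
  by move: (normr_ge0 (X q)) (normr_ge0 (Y q)); rewrite /C; split; lra.
have Ce : C * (4 * C)^-1 = 4^-1 by rewrite invfM mulrCA divff ?mulr1// gt_eqF.
move: (normr_ge0 (X q)) (normr_ge0 (Y q)).
move: (normr_ge0 ('D_(x - y) u q)) (normr_ge0 ('D_(x - y) v q)).
move: `|X q| `|Y q| `|'D_(x - y) u q| `|'D_(x - y) v q| H1 H2.
move: `|x - y| `|u x - u y| `|v x - v y| => n du dv A B a b H1 H2.
move=> a0 b0 A0 B0 [AC BC] nab.
have : a * A <= (du + (4 * C)^-1 * n) * C by apply: ler_pM.
have : b * B <= (dv + (4 * C)^-1 * n) * C by apply: ler_pM.
have CE m : (m + (4 * C)^-1 * n) * C = m * C + 4^-1 * n.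
  by rewrite mulrDl mulrAC [_^-1 * C]mulrC Ce.
rewrite !CE => h1 h2; lra.
Qed.

Lemma critical_point_zero (G : R * R -> R) x w (r : R) : 0 < r ->
  (forall y, ball x r y -> differentiable G y /\ G x <= G y) ->
  'D_w G x = 0.
Proof.
move=> r0 H.
have N0 : 0 < `|w| + 1 by rewrite ltr_pwDr.
pose d := r / (`|w| + 1); have d0 : 0 < d by rewrite divr_gt0.
have B t : t \in `]- d, d[%R -> ball x r (x + t *: w).
  rewrite in_itv/= -ltr_norml => td; rewrite -ball_normE /= opprD addNKr normrN normrZ.
  apply: (@le_lt_trans _ _ (d * `|w|)); first by apply: ler_wpM2r => //; exact: ltW.
  by rewrite /d mulrAC ltr_pdivrMr// ltr_pM2l// ltrDl.
have D t : t \in `]- d, d[%R ->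
    is_derive t 1 (fun s : R => G (x + s *: w)) ('D_w G (x + t *: w)).
  by move=> /B/H[dG _]; exact: is_derive_line.
have I0 : 0 \in `]- d, d[%R by rewrite in_itv/= oppr_lt0 d0.
have dd : - d <= d by lra.
have Dg t : t \in `]- d, d[%R -> derivable (fun s : R => G (x + s *: w)) t 1.
  by move=> td; have [] := D t td.
have Mg t : t \in `]- d, d[%R -> G (x + 0 *: w) <= G (x + t *: w).
  by move=> td; have [_] := H _ (B t td); rewrite scale0r addr0.
have [_ E] := derive1_at_min dd Dg I0 Mg.
by have [_] := D 0 I0; rewrite scale0r addr0 E.
Qed.

(** Minimise [G = (u - s)^2 + (v - t)^2] over a closed ball.  The
    Lipschitz bound makes [G] larger on the boundary than at the centre, so the
    minimum is interior, and there [D_X G = 2 (u - s)] and [D_Y G = 2 (v - t)]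
    vanish. *)
Lemma local_surjectivity q (r K : R) : U q -> 0 < r -> 0 < K ->
  ball q r `<=` U ->
  (forall x y, ball q r x -> ball q r y ->
    `|x - y| <= K * (`|u x - u y| + `|v x - v y|)) ->
  exists2 d : R, 0 < d & forall s t, `|s - u q| < d -> `|t - v q| < d ->
    exists2 x, ball q r x & u x = s /\ v x = t.
Proof.
move=> Uq r0 K0 sU Lip; pose rho := r / 2; pose d := rho / (6 * K).
have rho0 : 0 < rho by rewrite divr_gt0.
have d0 : 0 < d by rewrite divr_gt0// mulr_gt0.
exists d => // s t sd td.
pose A := `[q.1 - rho, q.1 + rho] `*` `[q.2 - rho, q.2 + rho].
have AP x : A x <-> `|q - x| <= rho.
  rewrite prod_normE ge_max /= !ler_norml /A /= !in_itv /=; split.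
    move=> [/andP[? ?] /andP[? ?]]; apply/andP; split; apply/andP; split; lra.
  move=> /andP[/andP[? ?] /andP[? ?]]; split; apply/andP; split; lra.
have Ball x : `|q - x| <= rho -> ball q r x.
  by rewrite -ball_normE /= => /le_lt_trans; apply; rewrite /rho; lra.
have [du _] := Cu; have [dv _] := Cv.
pose G : R * R -> R := fun x => (u x - s) * (u x - s) + (v x - t) * (v x - t).
have dG x : U x -> differentiable G x.
  move=> Ux; have dus : differentiable (u - cst s) x.
    by apply: differentiableB; [exact: du|exact: differentiable_cst].
  have dvt : differentiable (v - cst t) x.
    by apply: differentiableB; [exact: dv|exact: differentiable_cst].
  by apply: differentiableD; apply: differentiableM.
have DG x w : U x ->
    'D_w G x = 2 * (u x - s) * 'D_w u x + 2 * (v x - t) * 'D_w v x.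
  move=> Ux; have dus : is_derive x w (u - cst s) ('D_w u x - 0).
    apply: is_deriveB; apply: derivableP; apply: diff_derivable; exact: du.
  have dvt : is_derive x w (v - cst t) ('D_w v x - 0).
    apply: is_deriveB; apply: derivableP; apply: diff_derivable; exact: dv.
  have [_ E] := is_deriveD (is_deriveM dus dus) (is_deriveM dvt dvt).
  by apply: etrans E _; rewrite !fctE /GRing.scale /= !subr0; ring.
have [||| x] := @compact_EVT_min _ R G A.
- by exists q; apply/AP; rewrite subrr normr0 ltW.
- by apply: compact_setX; exact: segment_compact.
- apply: continuous_in_subspaceT => x; rewrite inE => /AP/Ball/sU Ux.
  by apply: differentiable_continuous; exact: dG.
rewrite inE => /AP qx minx.
have Bq : ball q r q by apply: Ball; rewrite subrr normr0 ltW.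
have Gqx : G x <= G q by apply: minx; rewrite inE; apply/AP; rewrite subrr normr0 ltW.
have Ux := sU _ (Ball _ qx).
have lt_qx : `|q - x| < rho.
  rewrite lt_neqAle qx andbT; apply/eqP => E.
  have := Lip q x Bq (Ball _ qx); rewrite E.
  (* the increments of [u] and [v] from [q] to [x] are below [3 d] each,
     which contradicts [rho <= K (|u q - u x| + |v q - v x|)] *)
  have rhod : rho = 6 * K * d by rewrite /d mulrCA divff ?mulr1// gt_eqF// mulr_gt0.
  rewrite rhod -mulrA mulrCA ler_pM2l//.
  move: Gqx sd td; rewrite /G; move: (u x) (v x) (u q) (v q) => a b a0 b0.
  rewrite !ltr_distl => Gx /andP[s1 s2] /andP[t1 t2].
  have sa0 : (a0 - s) * (a0 - s) <= d * d by nra.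
  have tb0 : (b0 - t) * (b0 - t) <= d * d by nra.
  have sa : `|a - s| < 2 * d.
    by apply: norm_lt_of_square => //; have := sqr_ge0 (b - t); rewrite expr2; lra.
  have tb : `|b - t| < 2 * d.
    by apply: norm_lt_of_square => //; have := sqr_ge0 (a - s); rewrite expr2; lra.
  move: sa tb; rewrite !ltr_norml => /andP[? ?] /andP[? ?].
  have : `|a0 - a| < 3 * d by rewrite ltr_norml; apply/andP; split; lra.
  have : `|b0 - b| < 3 * d by rewrite ltr_norml; apply/andP; split; lra.
  by lra.
exists x; first exact: Ball.
have crit w : 'D_w G x = 0.
  apply: (@critical_point_zero _ _ _ (rho - `|q - x|)); first by rewrite subr_gt0.
  move=> y; rewrite -ball_normE /= => xy.
  have qy : `|q - y| <= rho.
    by apply: le_trans (ler_distD x q y) _; rewrite addrC -lerBrDr ltW.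
  split; first by apply: dG; apply: sU; exact: Ball.
  by apply: minx; rewrite inE; exact/AP.
have [[ux vx] [uy vy]] := frame Ux.
have := crit (X x); have := crit (Y x); rewrite !DG// ux vx uy vy.
rewrite !mulr0 !mulr1 add0r addr0 => /eqP; rewrite mulf_eq0 pnatr_eq0 /= subr_eq0 => /eqP vt.
by move=> /eqP; rewrite mulf_eq0 pnatr_eq0 /= subr_eq0 => /eqP ut.
Qed.
End LocalInverse.

Section DerivativeAlongInverse.
Variable R : realType.

Lemma critical_negligible (V : normedModType R) (G : V -> R) x0 (e : R) :
  differentiable G x0 -> (forall w, 'D_w G x0 = 0) -> 0 < e ->
  \forall x \near x0, `|G x - G x0| <= e * `|x - x0|.
Proof.
move=> dG G0 e0; rewrite (near_shift 0) subr0.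
have /eqaddoP/(_ e e0) H := diff_locally dG.
apply: filterS H => h /=; rewrite !fctE /= -(deriveE _ dG) G0 addr0.
by rewrite addrK.
Qed.

(** A Lipschitz curve need not be differentiable, but [G] varies by
    [o(|x - x0|)] at a critical point, hence by [o(|t - s|)] along the curve. *)
Lemma is_derive_critical_comp (V : normedModType R) (G : V -> R) (sigma : R -> V)
    (s K : R) :
  differentiable G (sigma s) -> (forall w, 'D_w G (sigma s) = 0) -> 0 < K ->
  (\forall t \near s, `|sigma t - sigma s| <= K * `|t - s|) ->
  is_derive s 1 (G \o sigma) 0.
Proof.
move=> dG G0 K0 Lip.
have cs : {for s, continuous sigma}.
  apply/cvgrPdist_le => e e0; near=> t; rewrite distrC.
  apply: (@le_trans _ _ (K * `|t - s|)); first by near: t.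
  rewrite mulrC -ler_pdivlMr//; near: t.
  have e1 : 0 < e / K by rewrite divr_gt0.
  apply/nbhs_ballP; exists (e / K) => //= t; rewrite /ball /= distrC.
  exact: ltW.
have L : (fun h : R => h^-1 *: ((G \o sigma) (h *: (1 : R) + s) - (G \o sigma) s))
    @ 0^' --> (0 : R).
  apply/cvgrPdist_le => e e0.
  have e1 : 0 < e / K by rewrite divr_gt0.
  have nG := cs _ (critical_negligible dG G0 e1).
  have {nG Lip} : \forall t \near s, `|G (sigma t) - G (sigma s)| <= e * `|t - s|.
    near=> t; apply: (@le_trans _ _ (e / K * `|sigma t - sigma s|)); first by near: t.
    rewrite -mulrA ler_pM2l// ler_pdivrMl//.
    by near: t.
  rewrite (near_shift 0) subr0 => H.
  rewrite !near_withinE; apply: filterS H => h /= H h0.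
  rewrite sub0r normrN normrZ normfV ler_pdivrMl ?normr_gt0//.
  by rewrite [h *: 1]mulr1 mulrC; move: H; rewrite addrK.
have D : derivable (G \o sigma) s 1 by apply/cvg_ex; exists 0; exact: L.
by apply: DeriveDef => //; exact: cvg_lim L.
Unshelve. all: by end_near. Qed.

Variables (U : set (R * R)) (u v : R * R -> R) (X Y : R * R -> R * R).
Hypotheses (Cu : Cn_on 1 U u) (Cv : Cn_on 1 U v).
Hypothesis frame : dual_frame U u v X Y.

(** Subtracting from [F] the combination of [u] and [v] with the
    same differential at [sigma s] leaves a function to which
    [is_derive_critical_comp] applies, and [u], [v] are known along [sigma]. *)
Lemma is_derive_inverse_branch (F : R * R -> R) (sigma : R -> R * R) (s c K : R) :
  U (sigma s) -> differentiable F (sigma s) -> 0 < K ->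
  (\forall t \near s, u (sigma t) = t /\ v (sigma t) = c) ->
  (\forall t \near s, `|sigma t - sigma s| <= K * `|t - s|) ->
  is_derive s 1 (F \o sigma) ('D_(X (sigma s)) F (sigma s)).
Proof.
move=> Us dF K0 uv Lip; have [du _] := Cu; have [dv _] := Cv.
set x := sigma s; set a := 'D_(X x) F x; pose b := 'D_(Y x) F x.
pose G := F - a \*: u - b \*: v.
have dau : differentiable (a \*: u) x by apply: differentiableZ; exact: du.
have dbv : differentiable (b \*: v) x by apply: differentiableZ; exact: dv.
have dFu : differentiable (F - a \*: u) x by exact: differentiableB.
have dG : differentiable G x by exact: differentiableB.
have G0 w : 'D_w G x = 0.
  rewrite deriveB; [|exact: diff_derivable|exact: diff_derivable].
  rewrite deriveB; [|exact: diff_derivable|exact: diff_derivable].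
  rewrite deriveZ; last by apply: diff_derivable; exact: du.
  rewrite deriveZ; last by apply: diff_derivable; exact: dv.
  have E := dual_frame_expand Cu Cv frame w Us.
  have -> : 'D_w F x = 'D_w u x *: a + 'D_w v x *: b.
    by rewrite (deriveE w dF) [in LHS]E linearD 2!linearZ /= -!(deriveE _ dF).
  by rewrite /GRing.scale /=; ring.
have GD := is_derive_critical_comp dG G0 K0 Lip.
have ZD : is_derive s 1 (a \*: (@id R) : R -> R) (a *: 1).
  exact: is_deriveZ.
have CD : is_derive s 1 (cst (b * c) : R -> R) 0 by exact: is_derive_cst.
have SD : is_derive s 1 (((G \o sigma) + (a \*: (@id R) : R -> R)) + cst (b * c)) a.
  apply: is_derive_eq (is_deriveD (is_deriveD GD ZD) CD) _.
  by rewrite add0r addr0 [a *: 1]mulr1.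
apply: near_eq_is_derive SD; apply: filterS uv => t [ut vt].
by rewrite /G !fctE /= ut vt /GRing.scale /=; ring.
Qed.

End DerivativeAlongInverse.

Section InverseChart.
Variable R : realType.

Lemma smooth_derive_along (U : set (R * R)) (F : R * R -> R) (X : R * R -> R * R) :
  open U -> smooth_on U X -> smooth_on U F ->
  smooth_on U (fun x => 'D_(X x) F x).
Proof.
move=> oU CX CF n; have [dF DF] := CF n.+1.
have CX1 : Cn_on n U (fst \o X).
  by apply: Cn_on_linear_comp => //; exact: continuous_fst_pair.
have CX2 : Cn_on n U (snd \o X).
  by apply: Cn_on_linear_comp => //; exact: continuous_snd_pair.
apply: Cn_on_eq (Cn_on_add oU (Cn_on_mul oU CX1 (DF (1, 0)))
                              (Cn_on_mul oU CX2 (DF (0, 1)))) => // x Ux.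
by rewrite (derive_partials _ (dF x Ux)).
Qed.

(** [sigma] is an integral curve of [X], tested against functions.
    The derivative of [F o sigma] is [(D_X F) o sigma], so the induction on the
    order goes through for all [F] at once. *)
Lemma smooth_integral_curve (U : set (R * R)) (I : set R) (X : R * R -> R * R)
    (sigma : R -> R * R) :
  open U -> open I -> smooth_on U X ->
  (forall F : R * R -> R, (forall x, U x -> differentiable F x) ->
    forall s, I s -> is_derive s 1 (F \o sigma) ('D_(X (sigma s)) F (sigma s))) ->
  forall F : R * R -> R, smooth_on U F -> smooth_on (V := R) I (F \o sigma).
Proof.
move=> oU oI CX DX F CF n; elim: n F CF => [|n IH] F CF.
  move=> s Is; apply: differentiable_continuous; apply/derivable1_diffP.
  by have [dF _] := CF 1%N; have [] := DX F dF s Is.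
have [dF _] := CF 1%N.
have dFs s : I s -> differentiable (F \o sigma) s.
  by move=> Is; apply/derivable1_diffP; have [] := DX F dF s Is.
split=> // v.
pose XF := fun x => 'D_(X x) F x.
have CXF := smooth_derive_along oU CX CF.
apply: Cn_on_eq (Cn_on_mul oI (Cn_on_cst n I (v : R)) (IH _ CXF)) => // s Is.
rewrite -[in RHS](mulr1 v) -[v * 1]/(v *: 1) deriveZdir; last exact: dFs.
by have [_ ->] := DX F dF s Is.
Qed.

(** [Theta] is the inverse of [(u, v)] restricted to [N], over a square of
    side [2 d] around [(u0, v0)]. *)
Definition inverse_chart (U N : set (R * R)) (u v : R * R -> R) (u0 v0 d : R)
    (Theta : R -> R -> R * R) : Prop :=
  [/\ open N, N `<=` U,
    forall s t, ball u0 d s -> ball v0 d t ->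
      [/\ N (Theta s t), u (Theta s t) = s & v (Theta s t) = t] &
    forall x, N x -> ball u0 d (u x) -> ball v0 d (v x) ->
      Theta (u x) (v x) = x].

Lemma is_derive_chart (U : set (R * R)) (u v : R * R -> R)
    (X Y : R * R -> R * R) (q : R * R) (r K d : R) (Theta : R -> R -> R * R) :
  open U -> Cn_on 1 U u -> Cn_on 1 U v -> dual_frame U u v X Y -> 0 < K -> 0 < d ->
  ball q r `<=` U ->
  (forall x y, ball q r x -> ball q r y ->
    `|x - y| <= K * (`|u x - u y| + `|v x - v y|)) ->
  (forall s t, ball (u q) d s -> ball (v q) d t ->
      [/\ ball q r (Theta s t), u (Theta s t) = s & v (Theta s t) = t]) ->
  forall F : R * R -> R, (forall x, U x -> differentiable F x) ->
  forall s t, ball (u q) d s -> ball (v q) d t ->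
  is_derive s 1 (fun s => F (Theta s t)) ('D_(X (Theta s t)) F (Theta s t)).
Proof.
move=> oU Cu Cv frame K0 d0 sU Lip HT F dF s t Is It.
have [Bs us vs] := HT s t Is It.
have nI : \forall s' \near s, ball (u q) d s'.
  apply: open_nbhs_nbhs; split=> //; exact: ball_open.
apply: (@is_derive_inverse_branch _ _ _ _ _ _ Cu Cv frame F (Theta^~ t) s t K) => //.
- exact: sU.
- by apply: dF; exact: sU.
- by apply: filterS nI => s' Is'; have [] := HT s' t Is' It.
- apply: filterS nI => s' Is'; have [Bs' us' vs'] := HT s' t Is' It.
  by have := Lip _ _ Bs' Bs; rewrite us us' vs vs' subrr normr0 addr0.
Qed.

Lemma dual_frame_sym (U : set (R * R)) u v X Y :
  dual_frame U u v X Y -> dual_frame U v u Y X :> Prop.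
Proof. by move=> H x /H[[? ?] [? ?]]. Qed.

Theorem inverse_chart_exists (U : set (R * R)) (u v : R * R -> R)
    (X Y : R * R -> R * R) (q : R * R) :
  open U -> U q -> smooth_on U u -> smooth_on U v -> smooth_on U X ->
  smooth_on U Y -> dual_frame U u v X Y ->
  exists (N : set (R * R)) (d : R) (Theta : R -> R -> R * R),
  [/\ 0 < d, N q, inverse_chart U N u v (u q) (v q) d Theta &
  forall F : R * R -> R, smooth_on U F -> forall s t, ball (u q) d s -> ball (v q) d t ->
   [/\ smooth_on (V := R) (ball (u q) d) (fun s => F (Theta s t)),
       smooth_on (V := R) (ball (v q) d) (Theta s \; F),
       is_derive s 1 (fun s => F (Theta s t)) ('D_(X (Theta s t)) F (Theta s t)) &
       is_derive t 1 (Theta s \; F) ('D_(Y (Theta s t)) F (Theta s t))]].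
Proof.
move=> oU Uq Cu Cv CX CY frame.
have [r [K [r0 K0 sU Lip]]] := inverse_lipschitz oU (Cu 1%N) (Cv 1%N) frame Uq.
have [d d0 surj] := local_surjectivity (Cu 1%N) (Cv 1%N) frame Uq r0 K0 sU Lip.
have /choice[Th HTh] : forall st : R * R, exists x, ball (u q) d st.1 ->
    ball (v q) d st.2 -> [/\ ball q r x, u x = st.1 & v x = st.2].
  move=> [s t]; have [[ds dt]|nst] := pselect (ball (u q) d s /\ ball (v q) d t); last first.
    by exists 0 => ds dt; exfalso; exact: nst.
  have [|| x bx [ux vx]] := surj s t; [by rewrite distrC|by rewrite distrC|].
  by exists x.
pose Theta s t := Th (s, t).
have HT s t : ball (u q) d s -> ball (v q) d t ->
    [/\ ball q r (Theta s t), u (Theta s t) = s & v (Theta s t) = t].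
  exact: HTh (s, t).
have HT' t s : ball (v q) d t -> ball (u q) d s ->
    [/\ ball q r (Theta s t), v (Theta s t) = t & u (Theta s t) = s].
  by move=> It Is; have [? ? ?] := HT s t Is It.
have Lip' x y : ball q r x -> ball q r y ->
    `|x - y| <= K * (`|v x - v y| + `|u x - u y|).
  by rewrite [X in K * X]addrC; exact: Lip.
have DX := is_derive_chart oU (Cu 1%N) (Cv 1%N) frame K0 d0 sU Lip HT.
have DY := is_derive_chart oU (Cv 1%N) (Cu 1%N) (dual_frame_sym frame) K0 d0 sU Lip' HT'.
exists (ball q r), d, Theta; split=> //; first exact: ballxx.
  split=> //; first exact: ball_open.
  move=> x Nx Iu Iv; have [NT uT vT] := HT _ _ Iu Iv.
  apply/eqP; rewrite -subr_eq0 -normr_le0.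
  by have := Lip _ _ NT Nx; rewrite uT vT !subrr normr0 addr0 mulr0.
move=> F CF s t Is It; have [dF _] := CF 1%N; split.
- apply: (@smooth_integral_curve U _ X (Theta^~ t)) => //; first exact: ball_open.
  by move=> G dG s' Is'; exact: DX.
- apply: (@smooth_integral_curve U _ Y (Theta s)) => //; first exact: ball_open.
  by move=> G dG t' It'; exact: (DY G dG t' s It' Is).
- exact: DX.
- exact: (DY F dF t s It Is).
Qed.

End InverseChart.

(** * Fields tangent to an immersed surface *)

Section TangentFields.
Variable R : realType.
Local Notation D2 := (paracomplex2 R).

Lemma derive_field_derivative (U : set (R * R)) (F : R * R -> R) (Y : R * R -> R * R)
    (q w : R * R) :
  open U -> U q -> smooth_on U F -> smooth_on U Y ->
  'D_w (fun x => 'D_(Y x) F x) q =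
    (Y q).1 * (w.1 * 'D_(1, 0) (fun x => 'D_(1, 0) F x) q +
               w.2 * 'D_(0, 1) (fun x => 'D_(1, 0) F x) q) +
    'D_(1, 0) F q * ('D_w Y q).1 +
    ((Y q).2 * (w.1 * 'D_(1, 0) (fun x => 'D_(0, 1) F x) q +
                w.2 * 'D_(0, 1) (fun x => 'D_(0, 1) F x) q) +
     'D_(0, 1) F q * ('D_w Y q).2).
Proof.
move=> oU Uq CF CY; have [dF DF] := CF 2%N.
have [dY _] := CY 1%N.
have [dF1 _] := DF (1, 0); have [dF2 _] := DF (0, 1).
pose Y1 := fst \o Y; pose Y2 := snd \o Y.
have dY1 : differentiable Y1 q.
  apply: differentiable_comp; first exact: dY.
  by apply: linear_differentiable; exact: continuous_fst_pair.
have dY2 : differentiable Y2 q.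
  apply: differentiable_comp; first exact: dY.
  by apply: linear_differentiable; exact: continuous_snd_pair.
pose F1 : R * R -> R := 'D_(1, 0) F; pose F2 : R * R -> R := 'D_(0, 1) F.
have vY1 : derivable Y1 q w by exact: diff_derivable.
have vY2 : derivable Y2 q w by exact: diff_derivable.
have vF1 : derivable F1 q w by apply: diff_derivable; exact: dF1.
have vF2 : derivable F2 q w by apply: diff_derivable; exact: dF2.
have E : 'D_w (fun x => 'D_(Y x) F x) q = 'D_w (Y1 * F1 + Y2 * F2) q.
  apply: near_eq_derive; have nU : \near q, U q by exact: open_nbhs_nbhs.
  by apply: filterS nU => x Ux; rewrite (derive_partials _ (dF x Ux)).
have EY1 : 'D_w Y1 q = ('D_w Y q).1.
  exact: (derive_linear_comp w (@continuous_fst_pair R R R) (dY q Uq)).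
have EY2 : 'D_w Y2 q = ('D_w Y q).2.
  exact: (derive_linear_comp w (@continuous_snd_pair R R R) (dY q Uq)).
have EF1 : 'D_w F1 q = _ := derive_partials w (dF1 _ Uq).
have EF2 : 'D_w F2 q = _ := derive_partials w (dF2 _ Uq).
apply: etrans E (etrans (deriveD (derivableM vY1 vF1) (derivableM vY2 vF2)) _).
apply: congr2.
  apply: etrans (deriveM vY1 vF1) _.
  exact: congr2 (congr1 ( *%R (Y q).1) EF1) (congr1 ( *%R (F1 q)) EY1).
apply: etrans (deriveM vY2 vF2) _.
exact: congr2 (congr1 ( *%R (Y q).2) EF2) (congr1 ( *%R (F2 q)) EY2).
Qed.

Lemma commutator_coordinates (f1 f2 f11 f12 f21 f22 : R) (x y a b : R * R) :
  f12 = f21 ->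
  y.1 * (x.1 * f11 + x.2 * f21) + f1 * a.1 +
  (y.2 * (x.1 * f12 + x.2 * f22) + f2 * a.2) -
  (x.1 * (y.1 * f11 + y.2 * f21) + f1 * b.1 +
  (x.2 * (y.1 * f12 + y.2 * f22) + f2 * b.2)) =
  (a - b).1 *: f1 + (a - b).2 *: f2.
Proof.
move=> ->; case: x y a b => x1 x2 [y1 y2] [a1 a2] [b1 b2].
rewrite /GRing.scale /=; ring.
Qed.

(** The terms with second derivatives of [F] cancel by
    [derive_symmetric]. *)
Lemma derive_commutator (U : set (R * R)) (F : R * R -> R) (X Y : R * R -> R * R)
    (q : R * R) :
  open U -> U q -> smooth_on U F -> smooth_on U X -> smooth_on U Y ->
  'D_(X q) (fun x => 'D_(Y x) F x) q - 'D_(Y q) (fun x => 'D_(X x) F x) q =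
  'D_('D_(X q) Y q - 'D_(Y q) X q) F q.
Proof.
move=> oU Uq CF CX CY; have [dF _] := CF 1%N.
have EY := derive_field_derivative (X q) oU Uq CF CY.
have EX := derive_field_derivative (Y q) oU Uq CF CX.
have Esym := @derive_symmetric R (R * R)%type U F q (1, 0) (0, 1) oU Uq (CF 2%N).
have EW := derive_partials ('D_(X q) Y q - 'D_(Y q) X q) (dF _ Uq).
apply: etrans (congr2 (fun a b => a - b) EY EX) (etrans _ (esym EW)).
exact: commutator_coordinates.
Qed.

(** Linear forms separate points; this reduces identities between
    derivatives of [D^2]-valued maps to scalar ones. *)
Lemma paracomplex2_eq (z w : D2) :
  (forall l : {linear D2 -> R}, l z = l w) -> z = w.
Proof.
move=> E; have E11 := E (@fst R R \o @fst (R * R)%type (R * R)%type).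
have E12 := E (@snd R R \o @fst (R * R)%type (R * R)%type).
have E21 := E (@fst R R \o @snd (R * R)%type (R * R)%type).
have E22 := E (@snd R R \o @snd (R * R)%type (R * R)%type).
by case: z w E11 E12 E21 E22 {E} => -[? ?] [? ?] [[? ?] [? ?]] /= -> -> -> ->.
Qed.

Lemma smooth_on_paracomplex2 (V : normedModType R) (U : set V) (f : V -> D2) :
  open U -> (forall l : {linear D2 -> R}, smooth_on U (l \o f)) -> smooth_on U f.
Proof.
move=> oU Cf n.
have C11 := Cf (@fst R R \o @fst (R * R)%type (R * R)%type) n.
have C12 := Cf (@snd R R \o @fst (R * R)%type (R * R)%type) n.
have C21 := Cf (@fst R R \o @snd (R * R)%type (R * R)%type) n.
have C22 := Cf (@snd R R \o @snd (R * R)%type (R * R)%type) n.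
have C := Cn_on_pair oU (Cn_on_pair oU C11 C12) (Cn_on_pair oU C21 C22).
apply: Cn_on_eq C => // x _ /=.
by case: (f x) => -[? ?] [? ?].
Qed.

Variables (U : set (R * R)) (phi : R * R -> D2).
Hypotheses (oU : open U) (Cphi : smooth_on U phi).

Lemma linear_push (l : {linear D2 -> R}) (X : R * R -> R * R) x : U x ->
  l (push phi X x) = 'D_(X x) (l \o phi) x.
Proof.
move=> Ux; have [dphi _] := Cphi 1%N.
rewrite (derive_linear_comp _ (@linear_paracomplex2_continuous _ _ l) (dphi x Ux)).
by rewrite /push (deriveE _ (dphi x Ux)).
Qed.

Lemma smooth_linear_phi (l : {linear D2 -> R}) : smooth_on U (l \o phi).
Proof. by apply: smooth_on_linear_comp => //; exact: linear_paracomplex2_continuous. Qed.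

Lemma smooth_push (X : R * R -> R * R) : smooth_on U X -> smooth_on U (push phi X).
Proof.
move=> CX; apply: smooth_on_paracomplex2 => // l n.
have C := smooth_derive_along oU CX (smooth_linear_phi l).
by apply: Cn_on_eq (C n) => // x Ux; rewrite -linear_push.
Qed.

Lemma linear_derive_push (l : {linear D2 -> R}) (X : R * R -> R * R) (q w : R * R) :
  U q -> smooth_on U X ->
  l ('D_w (push phi X) q) = 'D_w (fun x => 'D_(X x) (l \o phi) x) q.
Proof.
move=> Uq CX; have [dX _] := smooth_push CX 1%N.
rewrite -(derive_linear_comp _ (@linear_paracomplex2_continuous _ _ l) (dX q Uq)).
apply: near_eq_derive; have nU : \near q, U q by exact: open_nbhs_nbhs.
by apply: filterS nU => x Ux; rewrite -linear_push.
Qed.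

(** The flat connection is torsion-free: tested on a linear form, this is
    [derive_commutator].  It is the symmetry of the second fundamental form. *)
Lemma push_commutator (X Y : R * R -> R * R) (q : R * R) :
  U q -> smooth_on U X -> smooth_on U Y ->
  'D_(X q) (push phi Y) q - 'D_(Y q) (push phi X) q =
  'd phi q ('D_(X q) Y q - 'D_(Y q) X q).
Proof.
move=> Uq CX CY; apply: paracomplex2_eq => l; have [dphi _] := Cphi 1%N.
have EY := linear_derive_push l (X q) Uq CY.
have EX := linear_derive_push l (Y q) Uq CX.
have EC := derive_commutator oU Uq (smooth_linear_phi l) CX CY.
have El := derive_linear_comp ('D_(X q) Y q - 'D_(Y q) X q)
  (@linear_paracomplex2_continuous _ _ l) (dphi q Uq).
apply: etrans (linearB l _ _) _.
apply: etrans (congr2 (fun a b => a - b) EY EX) _.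
apply: etrans EC (etrans El _).
have Ed := deriveE ('D_(X q) Y q - 'D_(Y q) X q) (dphi q Uq).
by rewrite Ed.
Qed.

End TangentFields.

(** * Null frames of a minimal surface *)

Section NullFrame.
Variable R : realType.
Local Notation D2 := (paracomplex2 R).

Lemma metricC (z w : D2) : metric z w = metric w z.
Proof. by rewrite /metric; ring. Qed.

Lemma metric_combl (x y : R) (z1 z2 w : D2) :
  metric (x *: z1 + y *: z2) w = x * metric z1 w + y * metric z2 w.
Proof.
case: z1 z2 w => -[? ?] [? ?] [[? ?] [? ?]] [[? ?] [? ?]].
by rewrite /metric /= /GRing.scale /=; ring.
Qed.

Lemma metric_combr (x y : R) (z1 z2 w : D2) :
  metric w (x *: z1 + y *: z2) = x * metric w z1 + y * metric w z2.
Proof. by rewrite metricC metric_combl !(metricC w). Qed.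

Lemma metric0l (w : D2) : metric 0 w = 0.
Proof. by rewrite /metric /=; ring. Qed.

(** Orthogonal vectors of nonzero square are independent, whatever the
    signature, so Cramer's rule applies to [v1] and [v2]. *)
Lemma orthonormal_spans (E : {linear (R * R)%type -> D2}) (v1 v2 : R * R) (s1 s2 : R) :
  metric (E v1) (E v1) = s1 -> metric (E v2) (E v2) = s2 ->
  metric (E v1) (E v2) = 0 -> s1 != 0 -> s2 != 0 ->
  forall w, exists x y : R, w = x *: v1 + y *: v2.
Proof.
move=> E11 E22 E12 s10 s20 w; pose D := v1.1 * v2.2 - v1.2 * v2.1.
have D0 : D != 0.
  apply/eqP => D0.
  have v22 : v2.2 = 0.
    have /(congr1 (fun z => metric (E z) (E v1))) : v2.2 *: v1 + (- v1.2) *: v2 = 0.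
      move: D0; rewrite /D; case: (v1) (v2) => [a b] [c d] /= D0.
      by congr (_, _); rewrite /= /GRing.scale /=; [rewrite -D0; ring|ring].
    rewrite linearD !linearZ metric_combl E11 (metricC (E v2)) E12 linear0 metric0l mulr0 addr0.
    by move=> /eqP; rewrite mulf_eq0 (negPf s10) orbF => /eqP.
  have v21 : v2.1 = 0.
    have /(congr1 (fun z => metric (E z) (E v1))) : v2.1 *: v1 + (- v1.1) *: v2 = 0.
      move: D0; rewrite /D; case: (v1) (v2) => [a b] [c d] /= D0.
      by congr (_, _); rewrite /= /GRing.scale /=; [ring|rewrite -oppr0 -D0; ring].
    rewrite linearD !linearZ metric_combl E11 (metricC (E v2)) E12 linear0 metric0l mulr0 addr0.
    by move=> /eqP; rewrite mulf_eq0 (negPf s10) orbF => /eqP.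
  have v20 : v2 = 0 by case: (v2) v21 v22 => a b /= -> ->.
  by move: s20; rewrite -E22 v20 linear0 metric0l eqxx.
exists ((w.1 * v2.2 - w.2 * v2.1) / D), ((v1.1 * w.2 - v1.2 * w.1) / D).
move: D0; rewrite /D; case: v1 v2 w {E11 E22 E12 D} => [a b] [c d] [e f] /= D0.
by congr (_, _); rewrite /= /GRing.scale /=; field.
Qed.

(** The orthogonal projection along the frame shows that the set from
    which [normal_part] chooses is not empty. *)
Lemma normal_part_tangent (T : set D2) (E1 E2 Z : D2) (s1 s2 : R) :
  T E1 -> T E2 -> (forall X, T X <-> exists x y : R, X = x *: E1 + y *: E2) ->
  metric E1 E1 = s1 -> metric E2 E2 = s2 -> metric E1 E2 = 0 ->
  s1 * s1 = 1 -> s2 * s2 = 1 -> T (Z - normal_part T Z).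
Proof.
move=> TE1 TE2 TP E11 E22 E12 s11 s22.
suff [_] : [set N | (forall X, T X -> metric X N = 0) /\ T (Z - N)] (normal_part T Z) by [].
apply: xgetPex.
pose a := s1 * metric E1 Z; pose b := s2 * metric E2 Z.
exists (1 *: Z + (- 1) *: (a *: E1 + b *: E2)); split.
  move=> X /TP[x [y ->]]; rewrite metric_combr !metric_combl !metric_combr.
  rewrite E11 E22 E12 (metricC E2 E1) E12 /a /b.
  have -> : x * (s1 * metric E1 Z * s1 + s2 * metric E2 Z * 0) +
    y * (s1 * metric E1 Z * 0 + s2 * metric E2 Z * s2) =
    x * metric E1 Z * (s1 * s1) + y * metric E2 Z * (s2 * s2) by ring.
  by rewrite s11 s22; ring.
apply/TP; exists a, b.
by rewrite scale1r scaleN1r opprD opprK addrA subrr add0r.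
Qed.

(** The fields live in the parameter domain, so that they can serve as
    directions of derivation along [phi]. *)
Definition null_frame (U : set (R * R)) (phi : R * R -> D2) (A B : R * R -> R * R) :=
  [/\ smooth_on U A, smooth_on U B & forall q, U q ->
   [/\ metric (push phi A q) (push phi A q) = 0,
       metric (push phi B q) (push phi B q) = 0,
       metric (push phi A q) (push phi B q) != 0 &
       forall w, exists x y : R, w = x *: A q + y *: B q]].

Lemma push_add (phi : R * R -> D2) X Y q : push phi (X + Y) q = push phi X q + push phi Y q.
Proof. exact: linearD. Qed.

Lemma push_sub (phi : R * R -> D2) X Y q : push phi (X - Y) q = push phi X q - push phi Y q.
Proof. exact: linearB. Qed.

(** In the frame the metric is [s1 x^2 + s2 y^2]; it takes both
    signs. *)
Lemma indefinite_opposite_signs (phi : R * R -> D2) (q v1 v2 : R * R) (s1 s2 : R) :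
  nondegenerate11 (tangent_plane phi q) ->
  metric ('d phi q v1) ('d phi q v1) = s1 ->
  metric ('d phi q v2) ('d phi q v2) = s2 ->
  metric ('d phi q v1) ('d phi q v2) = 0 ->
  (s1 = 1 \/ s1 = -1) -> (s2 = 1 \/ s2 = -1) -> s2 = - s1.
Proof.
move=> [_ [X [Y [TX TY _ XX YY]]]] E11 E22 E12 hs1 hs2.
have s10 : s1 != 0 by case: hs1 => ->; rewrite ?oppr_eq0 oner_eq0.
have s20 : s2 != 0 by case: hs2 => ->; rewrite ?oppr_eq0 oner_eq0.
have sp := orthonormal_spans E11 E22 E12 s10 s20.
have Q Z : tangent_plane phi q Z -> exists x y : R, metric Z Z = x ^+ 2 * s1 + y ^+ 2 * s2.
  move=> [w _ <-]; have [x [y ->]] := sp w; exists x, y.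
  rewrite linearD !linearZ metric_combl !metric_combr E11 E22 E12.
  by rewrite (metricC ('d phi q v2)) E12; ring.
have [x [y Ex]] := Q X TX; have [x' [y' Ey]] := Q Y TY.
move: XX YY; rewrite Ex Ey.
move: (sqr_ge0 x) (sqr_ge0 y) (sqr_ge0 x') (sqr_ge0 y').
by case: hs1 hs2 => -> [] -> *; lra.
Qed.

End NullFrame.

Section MinimalFrame.
Variable R : realType.
Local Notation D2 := (paracomplex2 R).

Lemma sum_differences (V : zmodType) (a b c d : V) :
  a - b + (c - d) = a - d + (c - b).
Proof. by rewrite addrACA [- b - d]addrC addrACA. Qed.

Lemma difference_sums (V : zmodType) (a b c d : V) :
  a + b - (c + d) = a - d - (c - b).
Proof. by rewrite opprB [b - c]addrC opprD addrACA [RHS]addrACA [- d + b]addrC. Qed.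

Variables (U : set (R * R)) (phi : R * R -> D2) (e1 e2 : R * R -> R * R).
Variables (s1 s2 : R).
Hypotheses (oU : open U) (Cphi : smooth_on U phi).
Hypothesis nondeg : forall q, U q -> nondegenerate11 (tangent_plane phi q).
Hypothesis frame : orthonormal_frame U phi e1 e2 s1 s2.
Hypothesis H0 : forall q, U q -> mean_curvature phi e1 e2 s1 s2 q = 0.

Let s11 : s1 * s1 = 1.
Proof. by have [_ [[] -> _] _] := frame; rewrite ?mulrNN mulr1. Qed.

Let s10 : s1 != 0.
Proof. by apply/eqP => h; move: s11; rewrite h mul0r => /eqP; rewrite eq_sym oner_eq0. Qed.

Lemma opposite_signs q : U q -> s2 = - s1.
Proof.
move=> Uq; have [_ [hs1 hs2] /(_ q Uq)[E11 E22 E12]] := frame.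
exact: indefinite_opposite_signs (nondeg Uq) E11 E22 E12 hs1 hs2.
Qed.

Lemma frame_spans q : U q -> forall w, exists x y : R, w = x *: e1 q + y *: e2 q.
Proof.
move=> Uq; have [_ _ /(_ q Uq)[E11 E22 E12]] := frame.
apply: orthonormal_spans E11 E22 E12 s10 _.
by rewrite (opposite_signs Uq) oppr_eq0.
Qed.

Lemma tangent_planeP q : U q -> forall X, tangent_plane phi q X <->
  exists x y : R, X = x *: push phi e1 q + y *: push phi e2 q.
Proof.
move=> Uq X; split=> [[w _ <-]|[x [y ->]]].
  have [x [y ->]] := frame_spans Uq w; exists x, y.
  by rewrite linearD !linearZ.
by exists (x *: e1 q + y *: e2 q) => //; rewrite linearD !linearZ.
Qed.

(** With opposite signs of the frame, [H = 0] says that the two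
    derivatives have the same normal part. *)
Lemma minimal_derivative_difference q : U q -> tangent_plane phi q
  ('D_(e1 q) (push phi e1) q - 'D_(e2 q) (push phi e2) q).
Proof.
move=> Uq; have s2E := opposite_signs Uq.
have [_ _ /(_ q Uq)[E11 E22 E12]] := frame.
have TP := tangent_planeP Uq.
have s22 : s2 * s2 = 1 by rewrite s2E mulrNN.
have T1 : tangent_plane phi q (push phi e1 q) by exists (e1 q).
have T2 : tangent_plane phi q (push phi e2 q) by exists (e2 q).
have NT Z := normal_part_tangent Z T1 T2 TP E11 E22 E12 s11 s22.
have := H0 Uq; rewrite /mean_curvature /second_ff s2E.
move: ('D_(e1 q) _ q) ('D_(e2 q) _ q) => Z1 Z2 /eqP.
rewrite scaleNr -scalerBr !scaler_eq0 invr_eq0 pnatr_eq0 (negPf s10) /= subr_eq0 => /eqP N12.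
have [w1 _ Ew1] := NT Z1; have [w2 _ Ew2] := NT Z2.
exists (w1 - w2) => //; rewrite linearB Ew1 Ew2 N12.
by rewrite opprB addrA subrK.
Qed.

Lemma commutator_tangent q : U q -> tangent_plane phi q
  ('D_(e1 q) (push phi e2) q - 'D_(e2 q) (push phi e1) q).
Proof.
move=> Uq; have [[C1 C2] _ _] := frame.
by rewrite (push_commutator oU Cphi Uq C1 C2); exists ('D_(e1 q) e2 q - 'D_(e2 q) e1 q).
Qed.

Lemma tangent_null_combination q Z : U q -> tangent_plane phi q Z ->
  exists x y : R, Z = x *: push phi (e1 + e2) q + y *: push phi (e1 - e2) q.
Proof.
move=> Uq /(tangent_planeP Uq)[x [y ->]]; exists ((x + y) / 2), ((x - y) / 2).
rewrite push_add push_sub scalerDr scalerBr addrACA -scalerDl -scalerBl.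
by congr (_ *: _ + _ *: _); field.
Qed.

Lemma minimal_null_frame : null_frame U phi (e1 + e2) (e1 - e2).
Proof.
have [[C1 C2] _ Fr] := frame.
split; [exact: smooth_on_add|exact: smooth_on_sub|].
move=> q Uq; have [E11 E22 E12] := Fr q Uq; have s2E := opposite_signs Uq.
have sumE : push phi (e1 + e2) q = 1 *: push phi e1 q + 1 *: push phi e2 q.
  by rewrite push_add !scale1r.
have subE : push phi (e1 - e2) q = 1 *: push phi e1 q + (- 1) *: push phi e2 q.
  by rewrite push_sub scale1r scaleN1r.
split.
- rewrite sumE metric_combl !metric_combr E11 E22 E12.
  by rewrite (metricC (push phi e2 q)) E12 s2E; ring.
- rewrite subE metric_combl !metric_combr E11 E22 E12.
  by rewrite (metricC (push phi e2 q)) E12 s2E; ring.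
- rewrite subE sumE metric_combl !metric_combr E11 E22 E12.
  rewrite (metricC (push phi e2 q)) E12 s2E.
  have -> : 1 * (1 * s1 + -1 * 0) + 1 * (1 * 0 + -1 * - s1) = 2 * s1 by ring.
  by rewrite mulf_neq0// pnatr_eq0.
move=> w; have [x [y ->]] := frame_spans Uq w.
exists ((x + y) / 2), ((x - y) / 2).
rewrite -[(e1 + e2) q]/(e1 q + e2 q) -[(e1 - e2) q]/(e1 q - e2 q).
rewrite scalerDr scalerBr addrACA -scalerDl -scalerBl.
by congr (_ *: _ + _ *: _); field.
Qed.

(** Expanding [D_(e1 -+ e2) (E1 +- E2)] leaves
    [D_e1 E1 - D_e2 E2] plus or minus the commutator, both tangent. *)
Lemma minimal_null_derivatives q : U q ->
  (exists x y : R, 'D_((e1 - e2) q) (push phi (e1 + e2)) q =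
     x *: push phi (e1 + e2) q + y *: push phi (e1 - e2) q) /\
  (exists x y : R, 'D_((e1 + e2) q) (push phi (e1 - e2)) q =
     x *: push phi (e1 + e2) q + y *: push phi (e1 - e2) q).
Proof.
move=> Uq; have [[C1 C2] _ _] := frame.
have [dE1 _] := smooth_push oU Cphi C1 1%N; have [dE2 _] := smooth_push oU Cphi C2 1%N.
have {}dE1 := dE1 q Uq; have {}dE2 := dE2 q Uq.
have [w1 _ Ew1] := minimal_derivative_difference Uq.
have [w2 _ Ew2] := commutator_tangent Uq.
have v1 v : derivable (push phi e1) q v by exact: diff_derivable.
have v2 v : derivable (push phi e2) q v by exact: diff_derivable.
have pD : push phi (e1 + e2) = push phi e1 + push phi e2.
  by apply/funext => x; exact: push_add.
have pB : push phi (e1 - e2) = push phi e1 - push phi e2.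
  by apply/funext => x; exact: push_sub.
split; apply: tangent_null_combination => //.
  exists (w1 + w2) => //; apply: etrans (linearD _ _ _) _.
  rewrite Ew1 Ew2 pD; apply/esym.
  apply: etrans (deriveD (v1 _) (v2 _)) _.
  apply: etrans (congr2 +%R (derive_dirB (e1 q) (e2 q) dE1) (derive_dirB (e1 q) (e2 q) dE2)) _.
  exact: sum_differences.
exists (w1 - w2) => //; apply: etrans (linearB _ _ _) _.
rewrite Ew1 Ew2 pB; apply/esym.
apply: etrans (deriveB (v1 _) (v2 _)) _.
apply: etrans (congr2 (fun a b => a - b) (derive_dirD (e1 q) (e2 q) dE1) (derive_dirD (e1 q) (e2 q) dE2)) _.
exact: difference_sums.
Qed.

End MinimalFrame.

(** * The slope of a null direction *)

Section Slope.
Variable R : realType.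
Local Notation D2 := (paracomplex2 R).

Definition null_p (z : R * R) : R := z.1 + z.2.
Definition null_q (z : R * R) : R := z.1 - z.2.

Fact null_p_linear : linear (null_p : R * R -> R^o).
Proof. by move=> a [b c] [d e]; rewrite /null_p /= /GRing.scale /=; ring. Qed.
Fact null_q_linear : linear (null_q : R * R -> R^o).
Proof. by move=> a [b c] [d e]; rewrite /null_q /= /GRing.scale /=; ring. Qed.
HB.instance Definition _ := GRing.isLinear.Build R (R * R)%type R^o *:%R null_p null_p_linear.
HB.instance Definition _ := GRing.isLinear.Build R (R * R)%type R^o *:%R null_q null_q_linear.

Definition coord_p1 : {linear D2 -> R} := null_p \o fst.
Definition coord_p2 : {linear D2 -> R} := null_p \o snd.
Definition coord_q1 : {linear D2 -> R} := null_q \o fst.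
Definition coord_q2 : {linear D2 -> R} := null_q \o snd.

Lemma metric_null_coords (z w : D2) : 2 * metric z w =
  coord_p1 z * coord_q1 w + coord_q1 z * coord_p1 w +
  (coord_p2 z * coord_q2 w + coord_q2 z * coord_p2 w).
Proof. by rewrite /metric /= /null_p /null_q; ring. Qed.

Lemma omega_null_coords (z w : D2) : 2 * omega z w =
  coord_q1 z * coord_p1 w - coord_p1 z * coord_q1 w +
  (coord_q2 z * coord_p2 w - coord_p2 z * coord_q2 w).
Proof. by rewrite /omega /metric /J /pcmul /= /null_p /null_q; ring. Qed.

(** The plane [q = lam i p], where [i (p1, p2) = (- p2, p1)]. *)
Definition on_null_plane (lam : R) (z : D2) : Prop :=
  coord_q1 z = - lam * coord_p2 z /\ coord_q2 z = lam * coord_p1 z.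

(** The coefficient of [q] on [i p] when [p] and [q] are orthogonal in [R^2]. *)
Definition slope (z : D2) : R :=
  (coord_q2 z * coord_p1 z - coord_q1 z * coord_p2 z) /
  (coord_p1 z * coord_p1 z + coord_p2 z * coord_p2 z).

Lemma null_vector_slope (p1 p2 q1 q2 : R) : p1 * q1 + p2 * q2 = 0 ->
  p1 * p1 + p2 * p2 != 0 ->
  let lam := (q2 * p1 - q1 * p2) / (p1 * p1 + p2 * p2) in
  q1 = - lam * p2 /\ q2 = lam * p1.
Proof.
move=> pq n0 lam; have En : lam * (p1 * p1 + p2 * p2) = q2 * p1 - q1 * p2 by rewrite divfK.
split; apply: (mulIf n0).
  have -> : - lam * p2 * (p1 * p1 + p2 * p2) = - p2 * (lam * (p1 * p1 + p2 * p2)) by ring.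
  rewrite En.
  have -> : q1 * (p1 * p1 + p2 * p2) = p1 * (p1 * q1 + p2 * q2) - p2 * (q2 * p1 - q1 * p2) by ring.
  by rewrite pq; ring.
have -> : lam * p1 * (p1 * p1 + p2 * p2) = p1 * (lam * (p1 * p1 + p2 * p2)) by ring.
rewrite En.
have -> : q2 * (p1 * p1 + p2 * p2) = p2 * (p1 * q1 + p2 * q2) + p1 * (q2 * p1 - q1 * p2) by ring.
by rewrite pq; ring.
Qed.

(** Let [q(a) = lam i p(a)] and [q(b) = mu i p(b)].  Then [2 <a, b>]
    and [2 omega (a, b)] are, up to sign, [(mu - lam) w] and [(mu + lam) w] with [w] the
    determinant of [p(a)] and [p(b)]. *)
Lemma null_planes_of_pair (a b : D2) :
  metric a a = 0 -> metric b b = 0 -> omega a b = 0 -> metric a b != 0 ->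
  [/\ coord_p1 a * coord_p1 a + coord_p2 a * coord_p2 a != 0,
      on_null_plane (slope a) a, on_null_plane (- slope a) b & slope a != 0].
Proof.
move=> aa bb oab mab.
have := metric_null_coords a a; have := metric_null_coords b b.
have := metric_null_coords a b; have := omega_null_coords a b.
rewrite aa bb oab /on_null_plane /slope !mulr0 => oE mE bE aE.
have mE0 : 2 * metric a b != 0 by rewrite mulf_neq0// pnatr_eq0.
move: mE0 oE {mab oab aa bb} aE bE; rewrite mE {mE}.
move: (coord_p1 a) (coord_p2 a) (coord_q1 a) (coord_q2 a) => p1 p2 q1 q2.
move: (coord_p1 b) (coord_p2 b) (coord_q1 b) (coord_q2 b) => r1 r2 s1 s2.
move=> m0 o0 a0 b0.
have {}a0 : p1 * q1 + p2 * q2 = 0 by lra.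
have {}b0 : r1 * s1 + r2 * s2 = 0 by lra.
have sq0 (x y : R) : x * x + y * y = 0 -> x = 0 /\ y = 0.
  move=> h; have x0 := sqr_ge0 x; have y0 := sqr_ge0 y; rewrite !expr2 in x0 y0.
  have /eqP : x * x = 0 by lra.
  have /eqP : y * y = 0 by lra.
  by rewrite !mulf_eq0 !orbb => /eqP -> /eqP ->.
have n0 : p1 * p1 + p2 * p2 != 0.
  apply/eqP => /sq0[p10 p20]; move: m0 o0; rewrite p10 p20 => /eqP m0 o0; apply: m0; lra.
have k0 : r1 * r1 + r2 * r2 != 0.
  apply/eqP => /sq0[p10 p20]; move: m0 o0; rewrite p10 p20 => /eqP m0 o0; apply: m0; lra.
have [Eq1 Eq2] := null_vector_slope a0 n0.
have [Es1 Es2] := null_vector_slope b0 k0.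
set lam := (q2 * p1 - _) / _ in Eq1 Eq2 *.
set mu := (s2 * r1 - _) / _ in Es1 Es2.
have w0 : p2 * r1 - p1 * r2 != 0.
  apply/eqP => w0; move/eqP: m0; apply.
  have -> : p1 * s1 + q1 * r1 + (p2 * s2 + q2 * r2) = (mu - lam) * (p2 * r1 - p1 * r2).
    by rewrite Eq1 Eq2 Es1 Es2; ring.
  by rewrite w0 mulr0.
have ml : mu = - lam.
  apply/eqP; rewrite -subr_eq0 opprK; apply/eqP; apply: (mulIf w0); rewrite mul0r.
  by move: o0; rewrite Eq1 Eq2 Es1 Es2 => o0; lra.
split=> //; first by rewrite -ml.
apply/eqP => l0; move/eqP: m0; apply.
by rewrite Eq1 Eq2 Es1 Es2 ml l0; ring.
Qed.

Lemma on_null_planes_independent (lam : R) (a b : D2) :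
  on_null_plane lam a -> on_null_plane (- lam) b -> metric a b != 0 ->
  coord_p1 a * coord_p2 b - coord_p2 a * coord_p1 b != 0.
Proof.
move=> [a1 a2] [b1 b2] m0; apply/eqP => w0; move/eqP: m0; apply.
apply: (@mulfI _ 2); first by rewrite pnatr_eq0.
rewrite mulr0 metric_null_coords a1 a2 b1 b2.
have -> : 0 = 2 * lam * (coord_p1 a * coord_p2 b - coord_p2 a * coord_p1 b).
  by rewrite w0 mulr0.
ring.
Qed.

(** Differentiating [q(c) = mu i p(c)] along [w] gives
    [mu' p(c) = - 2 mu y p(d)], because [d] has slope [- mu]; the vectors [p(c)]
    and [p(d)] are independent. *)
Lemma derive_null_plane_slope0 (mu : R * R -> R) (c : R * R -> D2) (d : D2) (q w : R * R) (x y : R) :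
  differentiable mu q -> differentiable c q ->
  (\forall t \near q, on_null_plane (mu t) (c t)) ->
  on_null_plane (- mu q) d -> metric (c q) d != 0 ->
  'D_w c q = x *: c q + y *: d -> 'D_w mu q = 0.
Proof.
move=> dmu dc nc nd md Dc.
have dl (l : {linear D2 -> R}) : derivable (l \o c) q w.
  apply: diff_derivable; apply: differentiable_comp => //.
  by apply: linear_differentiable; exact: linear_paracomplex2_continuous.
have El (l : {linear D2 -> R}) : 'D_w (l \o c) q = x * l (c q) + y * l d.
  apply: etrans (derive_linear_comp w (@linear_paracomplex2_continuous _ _ l) dc) _.
  by rewrite Dc linearD !linearZ.
have vmu : derivable mu q w by exact: diff_derivable.
have [nc1 nc2] := nbhs_singleton nc; have [nd1 nd2] := nd.
have E1 : 'D_w (coord_q1 \o c) q = 'D_w (- (mu * (coord_p2 \o c))) q.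
  apply: near_eq_derive; apply: filterS nc => t [h _].
  exact: etrans h (mulNr _ _).
have E2 : 'D_w (coord_q2 \o c) q = 'D_w (mu * (coord_p1 \o c)) q.
  by apply: near_eq_derive; apply: filterS nc => t [_ h]; exact: h.
have {}E1 := etrans E1 (etrans (deriveN (derivableM vmu (dl coord_p2)))
   (congr1 -%R (deriveM vmu (dl coord_p2)))).
have {}E2 := etrans E2 (deriveM vmu (dl coord_p1)).
have {}E1 := etrans (esym (El coord_q1)) E1.
have {}E2 := etrans (esym (El coord_q2)) E2.
rewrite (El coord_p2) nc1 nd1 in E1; rewrite (El coord_p1) nc2 nd2 in E2.
have {}E1 : x * (- mu q * coord_p2 (c q)) + y * (- - mu q * coord_p2 d) =
  - (mu q * (x * coord_p2 (c q) + y * coord_p2 d) + coord_p2 (c q) * 'D_w mu q) := E1.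
have {}E2 : x * (mu q * coord_p1 (c q)) + y * (- mu q * coord_p1 d) =
  mu q * (x * coord_p1 (c q) + y * coord_p1 d) + coord_p1 (c q) * 'D_w mu q := E2.
have w0 := on_null_planes_independent (conj nc1 nc2) (conj nd1 nd2) md.
move: ('D_w mu q) E1 E2 w0.
move: (coord_p1 (c q)) (coord_p2 (c q)) (coord_p1 d) (coord_p2 d) (mu q) => p1 p2 r1 r2 l.
move=> m E1 E2 w0;  apply: (mulIf w0); rewrite mul0r.
have F1 : m * p2 = - 2 * y * l * r2 by lra.
have F2 : m * p1 = - 2 * y * l * r1 by lra.
have -> : m * (p1 * r2 - p2 * r1) = m * p1 * r2 - m * p2 * r1 by ring.
by rewrite F1 F2; ring.
Qed.

End Slope.

(** * The splitting defined by a null plane *)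

Section Splitting.
Variable R : realType.
Local Notation D2 := (paracomplex2 R).

(** [derive_null_plane_slope0] for the field [A] along [B], and, with the
    slope negated, for the field [B] along [A]. *)
Lemma slope_derive0 (U : set (R * R)) (phi : R * R -> D2) (A B : R * R -> R * R) :
  open U -> smooth_on U phi -> null_frame U phi A B ->
  (forall q, U q -> omega (push phi A q) (push phi B q) = 0) ->
  (forall q, U q ->
    (exists x y : R, 'D_(B q) (push phi A) q = x *: push phi A q + y *: push phi B q) /\
    (exists x y : R, 'D_(A q) (push phi B) q = x *: push phi A q + y *: push phi B q)) ->
  forall q, U q -> differentiable (@slope R \o push phi A) q /\
    forall w, 'D_w (@slope R \o push phi A) q = 0.
Proof.
move=> oU Cphi [CA CB Fr] Om Tg.
have planes q : U q -> [/\ coord_p1 R (push phi A q) * coord_p1 R (push phi A q) +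
    coord_p2 R (push phi A q) * coord_p2 R (push phi A q) != 0,
    on_null_plane (slope (push phi A q)) (push phi A q) &
    on_null_plane (- slope (push phi A q)) (push phi B q)].
  move=> Uq; have [aa bb ab _] := Fr q Uq.
  by have [] := null_planes_of_pair aa bb (Om q Uq) ab.
have [dA _] := smooth_push oU Cphi CA 1%N; have [dB _] := smooth_push oU Cphi CB 1%N.
move=> q Uq; have {}dA := dA q Uq; have {}dB := dB q Uq.
have [n0 pA pB] := planes q Uq; have [aa bb ab span] := Fr q Uq.
have nU : \forall t \near q, U t by exact: open_nbhs_nbhs.
have dl (l : {linear D2 -> R}) : differentiable (l \o push phi A) q.
  apply: differentiable_comp => //.
  by apply: linear_differentiable; exact: linear_paracomplex2_continuous.
pose f1 := coord_p1 R \o push phi A; pose f2 := coord_p2 R \o push phi A.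
pose g1 := coord_q1 R \o push phi A; pose g2 := coord_q2 R \o push phi A.
have df1 : differentiable f1 q := dl (coord_p1 R).
have df2 : differentiable f2 q := dl (coord_p2 R).
have dg1 : differentiable g1 q := dl (coord_q1 R).
have dg2 : differentiable g2 q := dl (coord_q2 R).
have ds : differentiable (@slope R \o push phi A) q.
  have dn := differentiableB (differentiableM dg2 df1) (differentiableM dg1 df2).
  have dd := differentiableD (differentiableM df1 df1) (differentiableM df2 df2).
  exact: differentiableM dn (differentiableV dd n0).
split=> // w.
have [[x [y DBA]] [x' [y' DAB]]] := Tg q Uq.
have DBs : 'D_(B q) (@slope R \o push phi A) q = 0.
  apply: (derive_null_plane_slope0 ds dA _ pB ab DBA).
  by apply: filterS nU => t Ut; have [] := planes t Ut.
have DAs : 'D_(A q) (@slope R \o push phi A) q = 0.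
  have dns : differentiable (- (@slope R \o push phi A)) q by exact: differentiableN.
  have : 'D_(A q) (- (@slope R \o push phi A)) q = 0.
    apply: (@derive_null_plane_slope0 _ _ (push phi B) (push phi A q) _ _ y' x' dns dB).
    - by apply: filterS nU => t Ut; have [] := planes t Ut.
    - by rewrite !fctE opprK.
    - by rewrite metricC.
    - by rewrite DAB addrC.
  move=> DN; have vs : derivable (@slope R \o push phi A) q (A q) by exact: diff_derivable.
  have : - 'D_(A q) (@slope R \o push phi A) q = 0 by exact: etrans (esym (deriveN vs)) DN.
  by move=> /eqP; rewrite oppr_eq0 => /eqP.
have [s [t ->]] := span w.
apply: etrans (derive_dirD _ _ ds) _.
apply: etrans (congr2 +%R (deriveZdir (A q) s ds) (deriveZdir (B q) t ds)) _.
by rewrite DAs DBs !scaler0 addr0.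
Qed.

(** The [p]-coordinates of the component of [z] in the plane of slope [lam],
    for the decomposition into the planes of slopes [lam] and [- lam]. *)
Definition plane_coord (lam : R) (z : D2) : R * R :=
  (2^-1 * (coord_p1 R z + lam^-1 * coord_q2 R z),
   2^-1 * (coord_p2 R z - lam^-1 * coord_q1 R z)).

(** The vector with [p = m] and [q = lam i m]. *)
Definition plane_embed (lam : R) (m : R * R) : D2 :=
  ((2^-1 * (m.1 - lam * m.2), 2^-1 * (m.1 + lam * m.2)),
   (2^-1 * (m.2 + lam * m.1), 2^-1 * (m.2 - lam * m.1))).

Definition dot (c m : R * R) : R := c.1 * m.1 + c.2 * m.2.

Fact plane_coord_linear lam : linear (plane_coord lam).
Proof.
move=> a [[x1 y1] [x2 y2]] [[x1' y1'] [x2' y2']]; rewrite /plane_coord /=.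
by congr (_, _); rewrite /= /null_p /null_q /= /GRing.scale /=; ring.
Qed.

Fact plane_embed_linear lam : linear (plane_embed lam).
Proof.
move=> a [x1 y1] [x2 y2]; rewrite /plane_embed /=.
by congr (_, _); congr (_, _); rewrite /= /GRing.scale /=; ring.
Qed.

Fact dot_linear c : linear (dot c : R * R -> R^o).
Proof. by move=> a [x1 y1] [x2 y2]; rewrite /dot /= /GRing.scale /=; ring. Qed.

HB.instance Definition _ lam :=
  GRing.isLinear.Build R D2 (R * R)%type *:%R (plane_coord lam) (plane_coord_linear lam).
HB.instance Definition _ lam :=
  GRing.isLinear.Build R (R * R)%type D2 *:%R (plane_embed lam) (plane_embed_linear lam).
HB.instance Definition _ c :=
  GRing.isLinear.Build R (R * R)%type R^o *:%R (dot c) (dot_linear c).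

Lemma J_involutive (z : D2) : J (J z) = z.
Proof.
by case: z => -[a b] [c d]; rewrite /J /pcmul /= !(mul0r, mul1r, add0r).
Qed.

Lemma J_swap (z : D2) : J z = ((z.1.2, z.1.1), (z.2.2, z.2.1)).
Proof.
by case: z => -[a b] [c d]; rewrite /J /pcmul /= !(mul0r, mul1r, add0r).
Qed.

Variable lam : R.
Hypothesis lam0 : lam != 0.

Lemma plane_embedK m : plane_coord lam (plane_embed lam m) = m.
Proof.
case: m => a b; rewrite /plane_coord /plane_embed /= /null_p /null_q /=.
by congr (_, _); field.
Qed.

Lemma plane_coord_J_embed m : plane_coord lam (J (plane_embed lam m)) = 0.
Proof.
case: m => a b; rewrite J_swap /plane_coord /plane_embed /= /null_p /null_q /=.
by congr (_, _); field.
Qed.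

(** [J] exchanges the planes of slopes [lam] and [- lam], so the
    second component is [J] of the first component of [J z]. *)
Lemma plane_decomposition z :
  z = plane_embed lam (plane_coord lam z) + J (plane_embed lam (plane_coord lam (J z))).
Proof.
rewrite !J_swap; case: z => -[a b] [c d]; rewrite /plane_coord /plane_embed /= /null_p /null_q /=.
by congr (_, _); congr (_, _); rewrite /=; field.
Qed.

Lemma plane_coord_on z : on_null_plane lam z ->
  plane_coord lam z = (coord_p1 R z, coord_p2 R z) /\ plane_coord lam (J z) = 0.
Proof.
rewrite /on_null_plane J_swap; case: z => -[a b] [c d]; rewrite /plane_coord /= /null_p /null_q /=.
move=> [h1 h2].
have e1 : a = b - lam * (c + d) by rewrite -[a](subrK b) h1; ring.
have e2 : c = d + lam * (a + b) by rewrite -[c](subrK d) h2; ring.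
split; congr (_, _).
- by rewrite h2; field.
- by rewrite h1; field.
- by rewrite -[d - c]opprB h2; field.
- by rewrite -[b - a]opprB h1; field.
Qed.

Lemma plane_coord_on_J z : on_null_plane (- lam) z ->
  plane_coord lam (J z) = (coord_p1 R z, coord_p2 R z) /\ plane_coord lam z = 0.
Proof.
rewrite /on_null_plane J_swap; case: z => -[a b] [c d]; rewrite /plane_coord /= /null_p /null_q /=.
move=> [h1 h2]; split; congr (_, _).
- by rewrite -[d - c]opprB h2; field.
- by rewrite -[b - a]opprB h1; field.
- by rewrite h2; field.
- by rewrite h1; field.
Qed.

Definition null_plane_of : {vspace D2} := limg (linfun (plane_embed lam)).

Lemma plane_embed_in m : plane_embed lam m \in null_plane_of.
Proof. by rewrite -[plane_embed lam m]lfunE memv_img// memvf. Qed.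

Lemma null_plane_ofP z : z \in null_plane_of -> exists m, z = plane_embed lam m.
Proof. by move=> /memv_imgP[m _ ->]; exists m; rewrite lfunE. Qed.

Lemma null_plane_of_null : null_plane null_plane_of.
Proof.
split.
  rewrite limg_dim_eq; last first.
    apply/eqP; rewrite -subv0; apply/subvP => m; rewrite memv_cap memv_ker lfunE /= => /andP[_ /eqP E].
    by rewrite memv0 -(plane_embedK m) E linear0.
  by rewrite dimvf.
move=> X Y /null_plane_ofP[[a b] ->] /null_plane_ofP[[c d] ->].
by rewrite /metric /plane_embed /=; ring.
Qed.

Lemma null_plane_of_cap : (null_plane_of :&: JP null_plane_of = 0)%VS.
Proof.
apply/eqP; rewrite -subv0; apply/subvP => z; rewrite memv_cap memv0 => /andP[].
move=> /null_plane_ofP[m ->] /memv_imgP[w /null_plane_ofP[m' ->]]; rewrite lfunE /= => E.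
have : plane_coord lam (plane_embed lam m) = 0 by rewrite E plane_coord_J_embed.
by rewrite plane_embedK => ->; rewrite linear0.
Qed.

Lemma null_plane_of_add : (null_plane_of + JP null_plane_of = fullv)%VS.
Proof.
apply/eqP; rewrite eqEsubv subvf; apply/subvP => z _.
rewrite (plane_decomposition z); apply: memv_add; first exact: plane_embed_in.
by rewrite -[J _]lfunE memv_img// plane_embed_in.
Qed.

Lemma null_plane_of_not_lagrangian : ~ lagrangian_plane null_plane_of.
Proof.
move=> [_ /(_ _ _ (plane_embed_in (1, 0)) (plane_embed_in (0, 1)))].
rewrite /omega J_swap /metric /plane_embed /= => /eqP; apply/negP.
rewrite (_ : _ - _ = lam); last by field.
exact: lam0.
Qed.

(** If [J P] were inside [P], then [P] would be the whole
    space, which is not null. *)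
Lemma null_plane_of_not_complex : ~ complex_plane null_plane_of.
Proof.
move=> [dimP sub].
have := null_plane_of_add; rewrite (addv_idPl sub) => full.
have := null_plane_of_not_lagrangian; apply; split=> // X Y XP YP.
have [_ N] := null_plane_of_null; apply: N => //.
by rewrite full memvf.
Qed.

End Splitting.

(** * Product parametrizations *)

Section ProductParametrization.
Variable R : realType.
Local Notation D2 := (paracomplex2 R).

Lemma is_interval_ball (x r : R) : is_interval (ball x r).
Proof.
move=> a b; rewrite /ball /= !ltr_distl => /andP[a1 a2] /andP[b1 b2] c /andP[ac cb].
by rewrite ltr_distl; apply/andP; split; lra.
Qed.

Lemma open_interval_ball (x r : R) : 0 < r -> open_interval (ball x r).
Proof.
move=> r0; split; [by exists x; exact: ballxx|exact: ball_open|exact: is_interval_ball].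
Qed.

Lemma local_param_subset (L : set D2) (U U' : set (R * R)) (phi : R * R -> D2) :
  local_param L U phi -> open U' -> U' `<=` U -> local_param L U' phi.
Proof.
move=> [oU Cphi dinj inj opn] oU' sU; split=> //.
- by move=> n; exact: Cn_on_subset sU (Cphi n).
- by move=> q /sU; exact: dinj.
- by move=> x y; rewrite !inE => /sU Ux /sU Uy; apply: inj; rewrite inE.
- by move=> V oV sV; apply: opn => // x /sV/sU.
Qed.

(** [l] is a left inverse of the curve, so its derivative cannot
    vanish. *)
Lemma regular_curve_section (I : set R) (gamma : R -> D2) (l : {linear D2 -> R}) :
  open I -> smooth_on (V := R) I gamma -> (forall s, I s -> l (gamma s) = s) ->
  regular_curve I gamma.
Proof.
move=> oI Cg lg; split=> // s Is; rewrite derive1E; apply/eqP => D0.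
have [dg _] := Cg 1%N.
have E := derive_linear_comp (1 : R) (@linear_paracomplex2_continuous _ _ l) (dg s Is).
have nI : \forall t \near s, I t by exact: open_nbhs_nbhs.
have E1 : 'D_1 (l \o gamma) s = 'D_1 (@id R) s.
  by apply: near_eq_derive; apply: filterS nI => t It; exact: lg.
have : 'D_1 (@id R) s = 0 by rewrite -E1 E D0 linear0.
by rewrite derive_id => /eqP; rewrite oner_eq0.
Qed.

(** The pair [(l1, l2)] is a left inverse of [f], linear on the whole
    ambient space.  Hence [f] is an injective immersion, and the image of an open
    [V] is cut out of the image of the rectangle by the preimage of [V], an
    ambient open set. *)
Lemma local_param_section (L : set D2) (I1 I2 : set R) (g1 g2 : R -> D2)
    (l1 l2 : {linear D2 -> R}) :
  let f := fun q : R * R => g1 q.1 + J (g2 q.2) in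
  open I1 -> open I2 -> smooth_on (V := R) I1 g1 -> smooth_on (V := R) I2 g2 ->
  (forall q, (I1 `*` I2) q -> l1 (f q) = q.1 /\ l2 (f q) = q.2) ->
  (exists2 W, open W & f @` (I1 `*` I2) = L `&` W) ->
  local_param L (I1 `*` I2) f.
Proof.
move=> f oI1 oI2 C1 C2 lf [W0 oW0 fW0].
have oI : open (I1 `*` I2).
  have -> : I1 `*` I2 = fst @^-1` I1 `&` snd @^-1` I2 by [].
  apply: openI; apply: open_comp => // x _; [exact: cvg_fst|exact: cvg_snd].
have cJ : continuous (@J R) by exact: linear_paracomplex2_continuous.
have Cf : smooth_on (I1 `*` I2) f.
  move=> n; apply: (Cn_on_add oI).
    apply: (@Cn_on_subset _ _ _ _ (fst @^-1` I1)); first by move=> x [].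
    exact: (Cn_on_comp_linear oI1 (@continuous_fst_pair R R R) (C1 n)).
  apply: (Cn_on_linear_comp oI cJ).
  apply: (@Cn_on_subset _ _ _ _ (snd @^-1` I2)); first by move=> x [].
  exact: (Cn_on_comp_linear oI2 (@continuous_snd_pair R R R) (C2 n)).
split=> //.
- move=> q Iq w w' E; have [df _] := Cf 1%N.
  have nI : \forall x \near q, (I1 `*` I2) x by exact: open_nbhs_nbhs.
  have coord (l : {linear D2 -> R}) (k : {linear (R * R)%type -> R}) (z : R * R) :
      (forall x, (I1 `*` I2) x -> l (f x) = k x) -> l ('d f q z) = k z.
    move=> lk; have E1 := derive_linear_comp z (@linear_paracomplex2_continuous _ _ l) (df q Iq).
    have ck := @linear_plane_continuous _ _ k.
    have E2 : 'D_z (l \o f) q = 'D_z k q.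
      by apply: near_eq_derive; apply: filterS nI => x Ix; exact: lk.
    have E3 : 'D_z k q = k z.
      have dk : differentiable k q by exact: linear_differentiable.
      by rewrite (deriveE z dk) diff_lin.
    by rewrite -(deriveE z (df q Iq)) -E1 E2.
  have h1 z : l1 ('d f q z) = z.1 by apply: (coord l1 fst) => x /lf[].
  have h2 z : l2 ('d f q z) = z.2 by apply: (coord l2 snd) => x /lf[].
  have w1 : w.1 = w'.1 by rewrite -!h1 E.
  have w2 : w.2 = w'.2 by rewrite -!h2 E.
  by case: w w' w1 w2 {E} => a b [c d] /= -> ->.
- move=> x y; rewrite !inE => /lf[x1 x2] /lf[y1 y2] E.
  have e1 : l1 (f x) = l1 (f y) by rewrite E.
  have e2 : l2 (f x) = l2 (f y) by rewrite E.
  have := etrans (esym x1) (etrans e1 y1); have := etrans (esym x2) (etrans e2 y2).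
  by case: x y {x1 x2 y1 y2 E e1 e2} => a b [c d] /= -> ->.
move=> V oV sV; exists (W0 `&` [set z | V (l1 z, l2 z)]).
  apply: openI => //.
  have cl : continuous (fun z : D2 => (l1 z, l2 z)).
    move=> z; have c1 := @linear_paracomplex2_continuous _ _ l1 z.
    have c2 := @linear_paracomplex2_continuous _ _ l2 z.
    exact: cvg_pair c1 c2.
  by apply: (@open_comp _ _ (fun z : D2 => (l1 z, l2 z))) => // z _; exact: cl.
apply/seteqP; split=> z.
  move=> [q Vq <-]; have Iq := sV _ Vq; have [q1 q2] := lf q Iq.
  have [Lf Wf] : (L `&` W0) (f q) by rewrite -fW0; exists q.
  split=> //; split=> //=; rewrite q1 q2.
  by case: q Vq {Iq q1 q2 Lf Wf}.
move=> [Lz [Wz Vz]]; have [q Iq fq] : (f @` (I1 `*` I2)) z by rewrite fW0.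
exists q => //; move: Vz => /=; rewrite -fq; have [-> ->] := lf q Iq.
by case: q {Iq fq}.
Qed.

Lemma smooth_on_inv_scale (U : set (R * R)) (f : R * R -> R) (A : R * R -> R * R) :
  open U -> (forall x, U x -> f x != 0) -> smooth_on U f -> smooth_on U A ->
  smooth_on U (fun x => (f x)^-1 *: A x).
Proof.
move=> oU f0 Cf CA n; have Ci := Cn_on_inv oU f0 (Cf n).
have C1 := Cn_on_linear_comp oU (@continuous_fst_pair R R R) (CA n).
have C2 := Cn_on_linear_comp oU (@continuous_snd_pair R R R) (CA n).
apply: Cn_on_eq (Cn_on_pair oU (Cn_on_mul oU Ci C1) (Cn_on_mul oU Ci C2)) => //.
Qed.

(** The linear forms are the scalar products of the two plane
    components with their own values on the images of [A q] and [B q], so that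
    they are nonzero on these vectors. *)
Lemma product_parametrization (L : set D2) (U : set (R * R)) (phi : R * R -> D2)
    (A B : R * R -> R * R) (lam : R) (q : R * R) :
  lam != 0 -> local_param L U phi -> U q -> smooth_on U A -> smooth_on U B ->
  (forall x, U x -> on_null_plane lam (push phi A x) /\
                    on_null_plane (- lam) (push phi B x)) ->
  dot (plane_coord lam (push phi A q)) (plane_coord lam (push phi A q)) != 0 ->
  dot (plane_coord lam (J (push phi B q))) (plane_coord lam (J (push phi B q))) != 0 ->
  exists (I1 I2 : set R) (gamma1 gamma2 : R -> D2),
    [/\ open_interval I1 /\ regular_curve I1 gamma1,
        open_interval I2 /\ regular_curve I2 gamma2,
        (forall u, I1 u -> gamma1 u \in null_plane_of lam) /\
        (forall v, I2 v -> gamma2 v \in null_plane_of lam),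
        local_param L (I1 `*` I2) (fun x => gamma1 x.1 + J (gamma2 x.2)) &
        ((fun x => gamma1 x.1 + J (gamma2 x.2)) @` (I1 `*` I2)) (phi q)].
Proof.
move=> lam0 par Uq CA CB planes cA0 cB0; have [oU Cphi _ _ _] := par.
set c := plane_coord lam (push phi A q) in cA0.
set d := plane_coord lam (J (push phi B q)) in cB0.
pose lu : {linear D2 -> R} := dot c \o plane_coord lam.
pose lv : {linear D2 -> R} := dot d \o (plane_coord lam \o @J R).
pose u := lu \o phi; pose v := lv \o phi.
have Cu : smooth_on U u := smooth_linear_phi oU Cphi lu.
have Cv : smooth_on U v := smooth_linear_phi oU Cphi lv.
pose fA x := 'D_(A x) u x; pose fB x := 'D_(B x) v x.
have CfA : smooth_on U fA := smooth_derive_along oU CA Cu.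
have CfB : smooth_on U fB := smooth_derive_along oU CB Cv.
have fAE x : U x -> fA x = lu (push phi A x) by move=> Ux; rewrite (linear_push Cphi).
have fBE x : U x -> fB x = lv (push phi B x) by move=> Ux; rewrite (linear_push Cphi).
have fA0 : fA q != 0 by rewrite fAE.
have fB0 : fB q != 0 by rewrite fBE.
have [r r0 rU] : exists2 r : R, 0 < r & forall x, ball q r x ->
    [/\ U x, fA x != 0 & fB x != 0].
  have nU : \forall x \near q, U x by exact: open_nbhs_nbhs.
  have nA : \forall x \near q, fA x != 0 by exact: cvgr_neq0 (CfA 0%N q Uq) fA0.
  have nB : \forall x \near q, fB x != 0 by exact: cvgr_neq0 (CfB 0%N q Uq) fB0.
  have [r /= r0 rP] := (nbhs_ballP _ _).1 (filterI nU (filterI nA nB)).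
  by exists r => // x /rP[? [? ?]].
pose U' := ball q r; have sU : U' `<=` U by move=> x /rU[].
have oU' : open U' by exact: ball_open.
have sub (W : normedModType R) (f : R * R -> W) : smooth_on U f -> smooth_on U' f.
  by move=> Cf n; exact: Cn_on_subset sU (Cf n).
pose X x := (fA x)^-1 *: A x; pose Y x := (fB x)^-1 *: B x.
have CX : smooth_on U' X.
  by apply: smooth_on_inv_scale => // [x /rU[]//||]; exact: sub.
have CY : smooth_on U' Y.
  by apply: smooth_on_inv_scale => // [x /rU[]//||]; exact: sub.
have DXl (l : {linear D2 -> R}) x : U' x ->
    'D_(X x) (l \o phi) x = (fA x)^-1 * l (push phi A x).
  move=> /sU Ux; have [dl _] := smooth_linear_phi oU Cphi l 1%N.
  apply: etrans (deriveZdir (A x) (fA x)^-1 (dl x Ux)) _.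
  by rewrite (linear_push Cphi).
have DYl (l : {linear D2 -> R}) x : U' x ->
    'D_(Y x) (l \o phi) x = (fB x)^-1 * l (push phi B x).
  move=> /sU Ux; have [dl _] := smooth_linear_phi oU Cphi l 1%N.
  apply: etrans (deriveZdir (B x) (fB x)^-1 (dl x Ux)) _.
  by rewrite (linear_push Cphi).
have coordA x : U x -> plane_coord lam (J (push phi A x)) = 0.
  by move=> /planes[/(plane_coord_on lam0)[]].
have coordB x : U x -> plane_coord lam (push phi B x) = 0.
  by move=> /planes[_ /(plane_coord_on_J lam0)[]].
have frame : dual_frame U' u v X Y.
  move=> x U'x; have [Ux fAx fBx] := rU x U'x; split; split.
  - by apply: etrans (DXl lu x U'x) _; rewrite -fAE// mulVf.
  - by apply: etrans (DXl lv x U'x) _; rewrite /= coordA// linear0 mulr0.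
  - by apply: etrans (DYl lu x U'x) _; rewrite /= coordB// linear0 mulr0.
  - by apply: etrans (DYl lv x U'x) _; rewrite -fBE// mulVf.
have U'q : U' q by exact: ballxx.
have [N [e [Psi []]]] :=
  inverse_chart_exists oU' U'q (sub _ _ Cu) (sub _ _ Cv) CX CY frame.
move=> e0 Nq [oN sN HT HT'] DT.
set u0 := u q in HT HT' DT; set v0 := v q in HT HT' DT.
have Iu0 : ball u0 e u0 by exact: ballxx.
have Iv0 : ball v0 e v0 by exact: ballxx.
pose g1 s := plane_embed lam (plane_coord lam (phi (Psi s v0))).
pose g2 t := plane_embed lam (plane_coord lam (J (phi (Psi u0 t)))).
have Clin (l : {linear D2 -> R}) : smooth_on U' (l \o phi).
  by apply: sub; exact: smooth_linear_phi.
(* the component in the plane of slope [lam] does not see [v], as [Y] is proportional to [B] *)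
have const_t (l : {linear (R * R)%type -> R}) s t : ball u0 e s -> ball v0 e t ->
    l (plane_coord lam (phi (Psi s t))) = l (plane_coord lam (phi (Psi s v0))).
  move=> Is It; pose F := (l \o plane_coord lam : {linear D2 -> R}) \o phi.
  apply: (@derive0_constant _ (ball v0 e) (Psi s \; F) t v0) => //.
    exact: is_interval_ball.
  move=> t' It'; have [Nx _ _] := HT s t' Is It'.
  have [_ _ _ D] := DT F (Clin _) s t' Is It'.
  apply: is_derive_eq D _; apply: etrans (DYl (l \o plane_coord lam) _ (sN _ Nx)) _.
  by rewrite /= coordB ?linear0 ?mulr0//; apply: sU; exact: sN.
have const_s (l : {linear (R * R)%type -> R}) s t : ball u0 e s -> ball v0 e t ->
    l (plane_coord lam (J (phi (Psi s t)))) =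
    l (plane_coord lam (J (phi (Psi u0 t)))).
  move=> Is It; pose F := (l \o (plane_coord lam \o @J R) : {linear D2 -> R}) \o phi.
  apply: (@derive0_constant _ (ball u0 e) (fun s => F (Psi s t)) s u0) => //.
    exact: is_interval_ball.
  move=> s' Is'; have [Nx _ _] := HT s' t Is' It.
  have [_ _ D _] := DT F (Clin _) s' t Is' It.
  apply: is_derive_eq D _.
  apply: etrans (DXl (l \o (plane_coord lam \o @J R)) _ (sN _ Nx)) _.
  by rewrite /= coordA ?linear0 ?mulr0//; apply: sU; exact: sN.
have gE s t : ball u0 e s -> ball v0 e t -> g1 s + J (g2 t) = phi (Psi s t).
  move=> Is It; rewrite [RHS](plane_decomposition lam0); congr (_ + J _).
    rewrite /g1; congr (plane_embed lam _).
    have := const_t snd s t Is It; have := const_t fst s t Is It.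
    by case: (plane_coord lam _) (plane_coord lam _) => a b [a' b'] /= -> ->.
  rewrite /g2; congr (plane_embed lam _).
  have := const_s snd s t Is It; have := const_s fst s t Is It.
  by case: (plane_coord lam _) (plane_coord lam _) => a b [a' b'] /= -> ->.
have luE s : ball u0 e s -> lu (g1 s) = s.
  by move=> Is; have [_ us _] := HT s v0 Is Iv0; rewrite /= /g1 plane_embedK.
have lvE t : ball v0 e t -> lv (J (g2 t)) = t.
  by move=> It; have [_ _ vt] := HT u0 t Iu0 It; rewrite /= /g2 J_involutive plane_embedK.
have C1 : smooth_on (V := R) (ball u0 e) g1.
  apply: smooth_on_paracomplex2 => [|l]; first exact: ball_open.
  pose F := (l \o (plane_embed lam \o plane_coord lam) : {linear D2 -> R}) \o phi.
  by have [C _ _ _] := DT F (Clin _) u0 v0 Iu0 Iv0.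
have C2 : smooth_on (V := R) (ball v0 e) g2.
  apply: smooth_on_paracomplex2 => [|l]; first exact: ball_open.
  pose F := (l \o (plane_embed lam \o (plane_coord lam \o @J R)) : {linear D2 -> R}) \o phi.
  by have [_ C _ _] := DT F (Clin _) u0 v0 Iu0 Iv0.
have oI (x : R) : open (ball x e) by exact: ball_open.
have lP x : (ball u0 e `*` ball v0 e) x ->
    lu (g1 x.1 + J (g2 x.2)) = x.1 /\ lv (g1 x.1 + J (g2 x.2)) = x.2.
  move=> [Is It]; rewrite gE//.
  by have [_ us vt] := HT x.1 x.2 Is It.
exists (ball u0 e), (ball v0 e), g1, g2; split.
- split; first exact: open_interval_ball.
  exact: regular_curve_section luE.
- split; first exact: open_interval_ball.
  exact: (@regular_curve_section _ _ (lv \o @J R)).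
- by split=> s _; exact: plane_embed_in.
- apply: (@local_param_section L _ _ _ _ lu lv) => //.
  have [_ _ _ _ /(_ N oN (subset_trans sN sU))[W0 oW0 NW0]] := par.
  exists (W0 `&` [set z | ball u0 e (lu z) /\ ball v0 e (lv z)]).
    apply: openI => //; apply: openI.
      apply: (@open_comp _ _ lu) => // z _; exact: linear_paracomplex2_continuous.
    apply: (@open_comp _ _ lv) => // z _; exact: linear_paracomplex2_continuous.
  apply/seteqP; split=> z.
    move=> [x [Is It] <-]; have [l1 l2] := lP x (conj Is It).
    have [Nx _ _] := HT x.1 x.2 Is It.
    have [Lz Wz] : (L `&` W0) (g1 x.1 + J (g2 x.2)).
      by rewrite -NW0 gE//; exists (Psi x.1 x.2).
    have b1 : ball u0 e (lu (g1 x.1 + J (g2 x.2))) by rewrite l1.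
    have b2 : ball v0 e (lv (g1 x.1 + J (g2 x.2))) by rewrite l2.
    exact: conj Lz (conj Wz (conj b1 b2)).
  move=> [Lz [Wz [Iu Iv]]]; have [x Nx xz] : (phi @` N) z by rewrite NW0.
  rewrite -xz in Iu Iv; exists (u x, v x); first exact: conj Iu Iv.
  by rewrite -xz; apply: etrans (gE _ _ Iu Iv) _; rewrite (HT' x Nx Iu Iv).
exists (u0, v0); first exact: conj Iu0 Iv0.
by apply: etrans (gE _ _ Iu0 Iv0) _; rewrite (HT' q Nq Iu0 Iv0).
Qed.

End ProductParametrization.

Section ConstantSlope.
Variable R : realType.
Local Notation D2 := (paracomplex2 R).

(** The derivatives of the slope vanish ([slope_derive0]), so it is
    constant on a ball. *)
Lemma constant_null_planes (U : set (R * R)) (phi : R * R -> D2)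
    (A B : R * R -> R * R) (q : R * R) :
  open U -> smooth_on U phi -> null_frame U phi A B ->
  (forall x, U x -> omega (push phi A x) (push phi B x) = 0) ->
  (forall x, U x ->
    (exists s t : R, 'D_(B x) (push phi A) x = s *: push phi A x + t *: push phi B x) /\
    (exists s t : R, 'D_(A x) (push phi B) x = s *: push phi A x + t *: push phi B x)) ->
  U q -> exists2 r : R, 0 < r & ball q r `<=` U /\ forall x, ball q r x ->
    on_null_plane (slope (push phi A q)) (push phi A x) /\
    on_null_plane (- slope (push phi A q)) (push phi B x).
Proof.
move=> oU Cphi Fr Om Tg Uq; have [_ _ Fr'] := Fr.
have nU : \forall x \near q, U x by exact: open_nbhs_nbhs.
have [r /= r0 rU] := (nbhs_ballP _ _).1 nU.
exists r => //; split=> [//|x qx]; have Ux := rU x qx.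
have [aa bb ab _] := Fr' x Ux; have [_ pA pB _] := null_planes_of_pair aa bb (Om x Ux) ab.
have D y : ball q r y -> differentiable (@slope R \o push phi A) y /\
    forall w, 'D_w (@slope R \o push phi A) y = 0.
  by move=> /rU Uy; exact: slope_derive0 oU Cphi Fr Om Tg y Uy.
have E : slope (push phi A x) = slope (push phi A q) := derive0_constant_ball r0 D qx.
by rewrite -E.
Qed.

End ConstantSlope.

Theorem theorem4 (R : realType) (L : set (paracomplex2 R)) :
  surface L -> lagrangian L -> indefinite_metric L -> minimal L ->
  forall p, L p ->
  exists P : {vspace paracomplex2 R},
    [/\ null_plane P, ~ lagrangian_plane P, ~ complex_plane P &
        (P + JP P = fullv)%VS /\ (P :&: JP P = 0)%VS] /\
    exists (I1 I2 : set R) (gamma1 gamma2 : R -> paracomplex2 R),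
      [/\ open_interval I1 /\ regular_curve I1 gamma1,
          open_interval I2 /\ regular_curve I2 gamma2,
          (forall u, I1 u -> gamma1 u \in P) /\
          (forall v, I2 v -> gamma2 v \in P),
          local_param L (I1 `*` I2) (fun q => gamma1 q.1 + J (gamma2 q.2)) &
          ((fun q => gamma1 q.1 + J (gamma2 q.2)) @` (I1 `*` I2)) p].
Proof.
move=> _ lag ind min p Lp.
have [U [phi [e1 [e2 [s1 [s2 [par [q Uq <-] fr H0]]]]]]] := min p Lp.
have [oU Cphi _ _ _] := par.
have nd x : U x -> nondegenerate11 (tangent_plane phi x) := ind U phi par x.
have Fr := minimal_null_frame oU nd fr.
have Tg := minimal_null_derivatives oU Cphi nd fr H0.
set A := e1 + e2 in Fr Tg; set B := e1 - e2 in Fr Tg.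
have Om x : U x -> omega (push phi A x) (push phi B x) = 0.
  by move=> Ux; apply: (lag U phi par x Ux); [exists (A x)|exists (B x)].
have Om' x : U x -> omega (push phi B x) (push phi A x) = 0.
  by move=> Ux; apply: (lag U phi par x Ux); [exists (B x)|exists (A x)].
have [r r0 [sU planes]] := constant_null_planes oU Cphi Fr Om (fun x Ux => Tg x Ux) Uq.
have [CA CB Fr'] := Fr; have [aa bb ab _] := Fr' q Uq.
have [pA0 pA _ lam0] := null_planes_of_pair aa bb (Om q Uq) ab.
rewrite metricC in ab; have [pB0 _ _ _] := null_planes_of_pair bb aa (Om' q Uq) ab.
set lam := slope (push phi A q) in planes lam0 pA.
have qq : ball q r q by exact: ballxx.
have [_ pB] := planes q qq.
have [cA _] := plane_coord_on lam0 pA; have [cB _] := plane_coord_on_J lam0 pB.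
exists (null_plane_of lam); split.
  split; [exact: null_plane_of_null|exact: null_plane_of_not_lagrangian|
    exact: null_plane_of_not_complex|split].
    exact: null_plane_of_add.
  exact: null_plane_of_cap.
apply: (@product_parametrization _ L (ball q r) phi A B lam q) => //.
- by apply: local_param_subset par _ sU; exact: ball_open.
- by move=> n; exact: Cn_on_subset sU (CA n).
- by move=> n; exact: Cn_on_subset sU (CB n).
- by rewrite cA.
- by rewrite cB.
Qed.
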